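(* Let $A$ be a Green $\mathcal D$-biset functor such that the identity element $\varepsilon\in A(1)$ has a decomposition $\varepsilon=\sum_{i=1}^n e_i$ into orthogonal idempotents $e_1,\dots,e_n$ of the ring $CA(1)$. Then the category $A\text{-Mod}$ is equivalent to the product category $$\prod_{i=1}^n e_iA\text{-Mod}.$$ Moreover, for each indecomposable $A$-module $M$, there exists only one $e_i$ such that $e_iM\neq 0$, and hence $e_iM\cong M$.
   Context: Throughout, $R$ is a commutative unital ring, all groups are finite, and $\mathcal D$ is a non-empty class of finite groups closed under subquotients (so also under isomorphism) and cartesian products. The category $R\mathcal D$ has the groups in $\mathcal D$ as objects, $\mathrm{Hom}_{R\mathcal D}(G,H)=RB(H,G)=R\otimes_{\mathbb Z}B(H,G)$, where $B(H,G)$ is the Grothendieck group of finite $(H,G)$-bisets, and composition is induced by $V\circ U=V\times_G U$. A $\mathcal D$-biset functor is an $R$-linear functor $R\mathcal D\to R\text{-Mod}$; $\mathrm{Iso}$ denotes the biset of a group isomorphism; products of morphisms of $R\mathcal D$ are induced by cartesian products of bisets. A Green $\mathcal D$-biset functor is a $\mathcal D$-biset functor $A$ with $R$-bilinear products $A(G)\times A(H)\to A(G\times H)$, $(a,b)\mapsto a\times b$, and an identity element $\varepsilon\in A(1)$, associative and unital up to canonical group isomorphisms, with $A(\varphi\times\psi)(a\times b)=A(\varphi)(a)\times A(\psi)(b)$ for morphisms $\varphi,\psi$ of $R\mathcal D$. A (left) $A$-module is a $\mathcal D$-biset functor $M$ with bilinear products $A(G)\times M(H)\to M(G\times H)$ satisfying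 the analogous associativity, identity and functoriality conditions; morphisms of $A$-modules are natural transformations $f$ with $f(a\times m)=a\times f(m)$; this gives the abelian category $A\text{-Mod}$. $A(1)$ is a ring under $\times$ (identifying $1\times 1$ with $1$), with unity $\varepsilon$. The commutant at $G$ is $CA(G)=\{a\in A(G)\mid a\times b=A(\mathrm{Iso}_{H\times G}^{G\times H})(b\times a)\ \forall H\in\mathcal D,\forall b\in A(H)\}$; $CA(1)$ is a subring of $A(1)$. For an $A$-module $M$, $e_iM$ is the $A$-submodule of $M$ whose value at $H$ is $\{e_i\times m\mid m\in M(H)\}\subseteq M(H)$ (identifying $1\times H$ with $H$). $e_iA$ is a Green $\mathcal D$-biset functor with product $e_iA(G)\times e_iA(K)\to e_iA(G\times K)$, $(e_i\times a)\times(e_i\times b)=e_i\times a\times b$, and identity element $e_i\times\varepsilon=e_i$; $e_iA\text{-Mod}$ is its category of modules. *)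

(* Defs.v *)
From HB Require Import structures.
From mathcomp Require Import all_boot all_order all_fingroup all_algebra.
From mathcomp Require Import generic_quotient boolp.

Set Implicit Arguments.
Unset Strict Implicit.
Unset Printing Implicit Defensive.

Import GRing.Theory.
Local Open Scope ring_scope.
Local Open Scope quotient_scope.

Section Presentation.
Variables (R : pzRingType) (T : Type).

Inductive term : Type :=
| Tgen of T
| Tzero
| Topp of term
| Tadd of term & term
| Tscale of R & term.

Variable rel : term -> term -> Prop.

Inductive tcong : term -> term -> Prop :=
| tc_rel x y : rel x y -> tcong x y
| tc_refl x : tcong x x
| tc_sym x y : tcong x y -> tcong y x
| tc_trans x y z : tcong x y -> tcong y z -> tcong x z
| tc_opp x x' : tcong x x' -> tcong (Topp x) (Topp x')
| tc_add x x' y y' : tcong x x' -> tcong y y' -> tcong (Tadd x y) (Tadd x' y')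
| tc_scale r x x' : tcong x x' -> tcong (Tscale r x) (Tscale r x')
| tc_addA x y z : tcong (Tadd x (Tadd y z)) (Tadd (Tadd x y) z)
| tc_addC x y : tcong (Tadd x y) (Tadd y x)
| tc_add0 x : tcong (Tadd Tzero x) x
| tc_addN x : tcong (Tadd (Topp x) x) Tzero
| tc_scaleA r s x : tcong (Tscale r (Tscale s x)) (Tscale (r * s) x)
| tc_scale1 x : tcong (Tscale 1 x) x
| tc_scaleDr r x y : tcong (Tscale r (Tadd x y)) (Tadd (Tscale r x) (Tscale r y))
| tc_scaleDl r s x : tcong (Tscale (r + s) x) (Tadd (Tscale r x) (Tscale s x)).

HB.instance Definition _ := gen_eqMixin term.
HB.instance Definition _ := gen_choiceMixin term.

Definition tcongb (x y : term) : bool := `[< tcong x y >].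

Lemma tcongb_refl : reflexive tcongb.
Proof. by move=> x; apply/asboolP; apply: tc_refl. Qed.
Lemma tcongb_sym : symmetric tcongb.
Proof. by move=> x y; apply/asboolP/asboolP => /tc_sym. Qed.
Lemma tcongb_trans : transitive tcongb.
Proof.
by move=> y x z /asboolP xy /asboolP yz; apply/asboolP; apply: tc_trans xy yz.
Qed.

Canonical tcong_equiv := EquivRel tcongb tcongb_refl tcongb_sym tcongb_trans.

Definition presented : Type := {eq_quot tcongb}.
HB.instance Definition _ := Choice.on presented.

Definition pclass (x : term) : presented := \pi_{eq_quot tcongb} x.
Definition prepr (a : presented) : term := repr (a : {eq_quot tcongb}).

Lemma preprK a : pclass (prepr a) = a.
Proof. exact: reprK. Qed.

Lemma pclass_eq x y : pclass x = pclass y <-> tcong x y.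
Proof.
split=> [/eqmodP/asboolP //|xy].
by apply/eqmodP; apply/asboolP.
Qed.

Lemma prepr_cong x : tcong (prepr (pclass x)) x.
Proof. by apply/pclass_eq; rewrite preprK. Qed.

Definition p0 := pclass Tzero.
Definition popp a := pclass (Topp (prepr a)).
Definition padd a b := pclass (Tadd (prepr a) (prepr b)).
Definition pscale r a := pclass (Tscale r (prepr a)).

Lemma paddE x y : padd (pclass x) (pclass y) = pclass (Tadd x y).
Proof. by apply/pclass_eq/tc_add; apply: prepr_cong. Qed.
Lemma poppE x : popp (pclass x) = pclass (Topp x).
Proof. by apply/pclass_eq/tc_opp; apply: prepr_cong. Qed.
Lemma pscaleE r x : pscale r (pclass x) = pclass (Tscale r x).
Proof. by apply/pclass_eq/tc_scale; apply: prepr_cong. Qed.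

Lemma pind (P : presented -> Prop) : (forall x, P (pclass x)) -> forall a, P a.
Proof. by move=> h a; rewrite -(preprK a). Qed.

Lemma paddA : associative padd.
Proof.
elim/pind=> x; elim/pind=> y; elim/pind=> z; rewrite !paddE.
by apply/pclass_eq/tc_addA.
Qed.
Lemma paddC : commutative padd.
Proof.
by elim/pind=> x; elim/pind=> y; rewrite !paddE; apply/pclass_eq/tc_addC.
Qed.
Lemma padd0 : left_id p0 padd.
Proof. by elim/pind=> x; rewrite paddE; apply/pclass_eq/tc_add0. Qed.
Lemma paddN : left_inverse p0 popp padd.
Proof. by elim/pind=> x; rewrite poppE paddE; apply/pclass_eq/tc_addN. Qed.

HB.instance Definition _ := GRing.isZmodule.Build presented paddA paddC padd0 paddN.

Lemma pscaleA r s a : pscale r (pscale s a) = pscale (r * s) a.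
Proof. by elim/pind: a => x; rewrite !pscaleE; apply/pclass_eq/tc_scaleA. Qed.
Lemma pscale1 : left_id 1 pscale.
Proof. by elim/pind=> x; rewrite pscaleE; apply/pclass_eq/tc_scale1. Qed.
Lemma pscaleDr : right_distributive pscale +%R.
Proof.
move=> r; elim/pind=> x; elim/pind=> y.
change (pscale r (padd (pclass x) (pclass y)) =
        padd (pscale r (pclass x)) (pscale r (pclass y))).
by rewrite paddE !pscaleE paddE; apply/pclass_eq/tc_scaleDr.
Qed.
Lemma pscaleDl a : {morph pscale^~ a : r s / r + s}.
Proof.
elim/pind: a => x r s.
change (pscale (r + s) (pclass x) = padd (pscale r (pclass x)) (pscale s (pclass x))).
by rewrite !pscaleE paddE; apply/pclass_eq/tc_scaleDl.
Qed.

HB.instance Definition _ :=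
  GRing.Zmodule_isLmodule.Build R presented pscaleA pscale1 pscaleDr pscaleDl.

Lemma pclassD x y : pclass x + pclass y = pclass (Tadd x y).
Proof. exact: paddE. Qed.
Lemma pclassN x : - pclass x = pclass (Topp x).
Proof. exact: poppE. Qed.
Lemma pclassZ r x : r *: pclass x = pclass (Tscale r x).
Proof. exact: pscaleE. Qed.

Definition pgen (x : T) : presented := pclass (Tgen x).

Section Eval.
Variables (V : zmodType) (sc : R -> V -> V) (f : T -> V).

Fixpoint teval (t : term) : V :=
  match t with
  | Tgen x => f x
  | Tzero => 0
  | Topp x => - teval x
  | Tadd x y => teval x + teval y
  | Tscale r x => sc r (teval x)
  end.

(* The homomorphism with pgen x |-> f x, when f respects the relations; the
   value does not depend on the representative by [teval_cong] below. *)
Definition plift (a : presented) : V := teval (prepr a).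

Hypothesis scA : forall r s v, sc r (sc s v) = sc (r * s) v.
Hypothesis sc1 : forall v, sc 1 v = v.
Hypothesis scDr : forall r u v, sc r (u + v) = sc r u + sc r v.
Hypothesis scDl : forall r s v, sc (r + s) v = sc r v + sc s v.
Hypothesis frel : forall x y, rel x y -> teval x = teval y.

Lemma teval_cong x y : tcong x y -> teval x = teval y.
Proof.
elim=> //=.
- by move=> x0 y0 z0 _ -> _ ->.
- by move=> x0 x' _ ->.
- by move=> x0 x' y0 y' _ -> _ ->.
- by move=> r x0 x' _ ->.
- by move=> x0 y0 z; rewrite addrA.
- by move=> x0 y0; rewrite addrC.
- by move=> x0; rewrite add0r.
- by move=> x0; rewrite addNr.
Qed.

Lemma pliftE x : plift (pclass x) = teval x.
Proof. exact/teval_cong/prepr_cong. Qed.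
Lemma plift_gen x : plift (pgen x) = f x.
Proof. exact: pliftE. Qed.
Lemma plift_add a b : plift (a + b) = plift a + plift b.
Proof. by elim/pind: a => x; elim/pind: b => y; rewrite pclassD !pliftE. Qed.
Lemma plift_scale r a : plift (r *: a) = sc r (plift a).
Proof.
by elim/pind: a => x; rewrite pclassZ !pliftE.
Qed.
End Eval.

Lemma presented_ind (P : presented -> Prop) :
  (forall x, P (pgen x)) -> P 0 -> (forall a, P a -> P (- a)) ->
  (forall a b, P a -> P b -> P (a + b)) -> (forall r a, P a -> P (r *: a)) ->
  forall a, P a.
Proof.
move=> Pg P0 Po Pa Ps; elim/pind; elim=> [x||x Px|x Px y Py|r x Px].
- exact: Pg.
- exact: P0.
- by rewrite -pclassN; apply: Po.
- by rewrite -pclassD; apply: Pa.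
- by rewrite -pclassZ; apply: Ps.
Qed.

End Presentation.

Arguments Tzero {R T}.

Section Tensor.
Variables (R : pzRingType) (M : zmodType).

Inductive tensor_rel : term R (R * M) -> term R (R * M) -> Prop :=
| tensor_addl r s x : tensor_rel (Tgen _ (r + s, x)) (Tadd (Tgen _ (r, x)) (Tgen _ (s, x)))
| tensor_addr r x y : tensor_rel (Tgen _ (r, x + y)) (Tadd (Tgen _ (r, x)) (Tgen _ (r, y)))
| tensor_scale r s x : tensor_rel (Tgen _ (r * s, x)) (Tscale r (Tgen _ (s, x))).

Definition tensorZ : lmodType R := presented tensor_rel.

Definition tensorZ_elt (r : R) (x : M) : tensorZ := pgen tensor_rel (r, x).

Definition tensorZ_lift (V : lmodType R) (f : M -> V) : tensorZ -> V :=
  plift (rel := tensor_rel) (@GRing.scale R V) (fun rx => rx.1 *: f rx.2).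

Section Lift.
Variables (V : lmodType R) (f : M -> V).
Hypothesis fD : forall x y, f (x + y) = f x + f y.

Let frel x y : tensor_rel x y ->
  teval (@GRing.scale R V) (fun rx : R * M => rx.1 *: f rx.2) x =
  teval (@GRing.scale R V) (fun rx : R * M => rx.1 *: f rx.2) y.
Proof.
case=> /=.
- by move=> r s z; rewrite scalerDl.
- by move=> r z z'; rewrite fD scalerDr.
- by move=> r s z; rewrite scalerA.
Qed.

Lemma tensorZ_liftE r x : tensorZ_lift f (tensorZ_elt r x) = r *: f x.
Proof.
apply: plift_gen => //.
- exact: scalerA.
- exact: scale1r.
- exact: scalerDr.
- by move=> *; rewrite scalerDl.
Qed.
Lemma tensorZ_liftD a b : tensorZ_lift f (a + b) = tensorZ_lift f a + tensorZ_lift f b.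
Proof.
apply: plift_add => //.
- exact: scalerA.
- exact: scale1r.
- exact: scalerDr.
- by move=> *; rewrite scalerDl.
Qed.
Lemma tensorZ_liftZ r a : tensorZ_lift f (r *: a) = r *: tensorZ_lift f a.
Proof.
apply: plift_scale => //.
- exact: scalerA.
- exact: scale1r.
- exact: scalerDr.
- by move=> *; rewrite scalerDl.
Qed.
End Lift.

Lemma tensorZ_eltD r x y :
  tensorZ_elt r (x + y) = tensorZ_elt r x + tensorZ_elt r y.
Proof.
rewrite /tensorZ_elt /pgen pclassD; apply/pclass_eq/tc_rel.
exact: tensor_addr.
Qed.

Lemma tensorZ_eltZ r x : tensorZ_elt r x = r *: tensorZ_elt 1 x.
Proof.
rewrite /tensorZ_elt /pgen pclassZ; apply/pclass_eq/tc_rel.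
rewrite -{1}[r]mulr1; exact: tensor_scale.
Qed.

End Tensor.

Record biset_on (H G : finGroupType) (X : Type) := BisetOn {
  lact : H -> X -> X;
  ract : X -> G -> X;
  lact1 : forall x, lact 1%g x = x;
  lactM : forall h k x, lact (h * k)%g x = lact h (lact k x);
  ract1 : forall x, ract x 1%g = x;
  ractM : forall x g k, ract x (g * k)%g = ract (ract x g) k;
  lractA : forall h x g, lact h (ract x g) = ract (lact h x) g
}.

Record biset (H G : finGroupType) := Biset {
  bcar :> finType;
  bstr :> biset_on H G bcar
}.

(* X --> Y is a bijective map intertwining the actions along p and q; for
   p = id and q = id these are the isomorphisms of bisets. *)
Definition biset_iso_along (H H' G G' : finGroupType) (p : H -> H') (q : G -> G')
    (X : biset H G) (Y : biset H' G') :=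
  exists f : X -> Y, [/\ bijective f,
    forall h x, f (lact X h x) = lact Y (p h) (f x) &
    forall x g, f (ract X x g) = ract Y (f x) (q g)].

Definition biset_iso (H G : finGroupType) (X Y : biset H G) :=
  biset_iso_along id id X Y.

Lemma bij_of_inj_surj (X Y : finType) (f : X -> Y) :
  injective f -> (forall y, exists x, f x = y) -> bijective f.
Proof.
move=> fi fs; have fs' y : exists x, f x == y by have [x <-] := fs y; exists x.
exists (fun y => xchoose (fs' y)) => [x|y]; last exact/eqP/(xchooseP (fs' y)).
exact/fi/eqP/(xchooseP (fs' (f x))).
Qed.

Lemma biset_iso_refl H G (X : biset H G) : biset_iso X X.
Proof. by exists id; split=> //; exists id. Qed.
Lemma biset_iso_sym H G (X Y : biset H G) : biset_iso X Y -> biset_iso Y X.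
Proof.
case=> f [[g fK gK] fl fr]; exists g; split; first by exists f.
  by move=> h y; rewrite -{1}[y]gK -fl fK.
by move=> y h; rewrite -{1}[y]gK -fr fK.
Qed.
Lemma biset_iso_trans H G (X Y Z : biset H G) :
  biset_iso X Y -> biset_iso Y Z -> biset_iso X Z.
Proof.
case=> f [fb fl fr] [g [gb gl gr]]; exists (g \o f); split.
- exact: bij_comp.
- by move=> h x /=; rewrite fl gl.
- by move=> x h /=; rewrite fr gr.
Qed.

Section BisetSum.
Variables (H G : finGroupType) (X Y : biset H G).

Definition bsum_l (h : H) (u : X + Y) : X + Y :=
  match u with inl x => inl (lact X h x) | inr y => inr (lact Y h y) end.
Definition bsum_r (u : X + Y) (g : G) : X + Y :=
  match u with inl x => inl (ract X x g) | inr y => inr (ract Y y g) end.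

Definition bsum_on : biset_on H G (X + Y)%type.
Proof.
exists bsum_l bsum_r.
- by case=> u /=; rewrite lact1.
- by move=> h k [] u /=; rewrite lactM.
- by case=> u /=; rewrite ract1.
- by move=> [] u h k /=; rewrite ractM.
- by move=> h [] u g /=; rewrite lractA.
Defined.

Definition bsum : biset H G := Biset bsum_on.
End BisetSum.

Section BisetProd.
Variables (H G H' G' : finGroupType) (X : biset H G) (Y : biset H' G').

Definition bprod_l (h : H * H') (u : X * Y) : X * Y :=
  (lact X h.1 u.1, lact Y h.2 u.2).
Definition bprod_r (u : X * Y) (g : G * G') : X * Y :=
  (ract X u.1 g.1, ract Y u.2 g.2).

Definition bprod_on : biset_on (H * H')%type (G * G')%type (X * Y)%type.
Proof.
exists bprod_l bprod_r.
- by case=> x y; congr pair; exact: lact1.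
- by move=> h k [x y]; congr pair; exact: lactM.
- by case=> x y; congr pair; exact: ract1.
- by move=> [x y] h k; congr pair; exact: ractM.
- by move=> h [x y] g; rewrite /bprod_r /bprod_l /= !lractA.
Defined.

Definition bprod : biset (H * H')%type (G * G')%type := Biset bprod_on.
End BisetProd.

Section BisetTensor.
Variables (K H G : finGroupType) (V : biset K H) (U : biset H G).

(* V x_H U is the quotient of V x U by (v h, u) ~ (v, h u). *)
Definition tens_rel (p q : V * U) : bool :=
  [exists h : H, q == (ract V p.1 h, lact U h^-1%g p.2)].

Lemma tens_rel_refl p : tens_rel p p.
Proof. by apply/existsP; exists 1%g; rewrite invg1 ract1 lact1 -surjective_pairing. Qed.
Lemma tens_rel_sym p q : tens_rel p q -> tens_rel q p.
Proof.
case/existsP=> h /eqP->; apply/existsP; exists h^-1%g => /=.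
by rewrite -ractM -lactM mulgV mulVg ract1 lact1 -surjective_pairing.
Qed.
Lemma tens_rel_trans p q r : tens_rel p q -> tens_rel q r -> tens_rel p r.
Proof.
case/existsP=> h /eqP-> /existsP[k /eqP->]; apply/existsP; exists (h * k)%g => /=.
by rewrite -ractM -lactM invMg.
Qed.

Definition tens_class (p : V * U) : {set V * U} := [set q | tens_rel p q].

Lemma tens_classP p q : tens_class p = tens_class q <-> tens_rel p q.
Proof.
split=> [/setP/(_ q)|pq]; first by rewrite !inE tens_rel_refl.
apply/setP=> r; rewrite !inE; apply/idP/idP; apply: tens_rel_trans => //.
exact: tens_rel_sym.
Qed.

Definition tens_car := {S : {set V * U} | [exists p, S == tens_class p]}.

Lemma tens_pi_subproof p : [exists q, tens_class p == tens_class q].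
Proof. by apply/existsP; exists p. Qed.
Definition tens_pi (p : V * U) : tens_car := exist _ (tens_class p) (tens_pi_subproof p).

Lemma tens_rep_subproof (S : tens_car) : exists p, val S == tens_class p.
Proof. exact/existsP/(svalP S). Qed.
Definition tens_rep (S : tens_car) : V * U := xchoose (tens_rep_subproof S).

Lemma tens_repK S : tens_pi (tens_rep S) = S.
Proof. by apply/val_inj/esym/eqP/(xchooseP (tens_rep_subproof S)). Qed.
Lemma tens_piP p q : tens_pi p = tens_pi q <-> tens_rel p q.
Proof.
split=> [|pq]; first by case=> /tens_classP.
by apply: val_inj; apply/tens_classP.
Qed.
Lemma tens_pi_rep p : tens_rel (tens_rep (tens_pi p)) p.
Proof. by apply/tens_piP; rewrite tens_repK. Qed.
Lemma tens_pi_mid v h u : tens_pi (ract V v h, u) = tens_pi (v, lact U h u).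
Proof.
apply/esym/tens_piP/existsP; exists h => /=.
by rewrite -lactM mulVg lact1.
Qed.

Definition tens_l (k : K) (S : tens_car) : tens_car :=
  let p := tens_rep S in tens_pi (lact V k p.1, p.2).
Definition tens_r (S : tens_car) (g : G) : tens_car :=
  let p := tens_rep S in tens_pi (p.1, ract U p.2 g).

Lemma tens_lE k p : tens_l k (tens_pi p) = tens_pi (lact V k p.1, p.2).
Proof.
have /tens_rel_sym/existsP[h /eqP E] := tens_pi_rep p.
rewrite /tens_l E /=; apply/esym/tens_piP/existsP; exists h => /=.
by rewrite lractA.
Qed.
Lemma tens_rE p g : tens_r (tens_pi p) g = tens_pi (p.1, ract U p.2 g).
Proof.
have /tens_rel_sym/existsP[h /eqP E] := tens_pi_rep p.
rewrite /tens_r E /=; apply/esym/tens_piP/existsP; exists h => /=.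
by rewrite lractA.
Qed.

Definition tens_on : biset_on K G tens_car.
Proof.
exists tens_l tens_r.
- by move=> S; rewrite -[S]tens_repK tens_lE lact1 -surjective_pairing.
- by move=> h k S; rewrite -[S]tens_repK !tens_lE lactM.
- by move=> S; rewrite -[S]tens_repK tens_rE ract1 -surjective_pairing.
- by move=> S h k; rewrite -[S]tens_repK !tens_rE ractM.
- by move=> h S k; rewrite -[S]tens_repK !(tens_rE, tens_lE).
Defined.

Definition btens : biset K G := Biset tens_on.

Lemma btens_iso_intro (W : biset K G) (f : V * U -> W) :
  (forall p q, f p = f q <-> tens_rel p q) -> (forall w, exists p, f p = w) ->
  (forall k v u, f (lact V k v, u) = lact W k (f (v, u))) ->
  (forall v u g, f (v, ract U u g) = ract W (f (v, u)) g) ->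
  biset_iso btens W.
Proof.
move=> fP fs fl fr; exists (fun S : tens_car => f (tens_rep S)).
have E p : f (tens_rep (tens_pi p)) = f p by apply/fP/tens_pi_rep.
split.
- apply: bij_of_inj_surj => [S T /fP|w].
    by move/tens_piP; rewrite !tens_repK.
  by have [p <-] := fs w; exists (tens_pi p).
- move=> k S; rewrite -[S]tens_repK /= tens_lE !E fl.
  by rewrite -surjective_pairing.
- move=> S g; rewrite -[S]tens_repK /= tens_rE !E fr.
  by rewrite -surjective_pairing.
Qed.

End BisetTensor.

Record giso (G H : finGroupType) := GIso {
  giso_fun :> G -> H;
  gisoM : {morph giso_fun : x y / (x * y)%g};
  giso_bij : bijective giso_fun
}.

(* Iso(f) for f : G -> H is the (H,G)-biset H with h . x . g = h x f(g). *)
Section IsoBiset.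
Variables (G H : finGroupType) (f : giso G H).

Lemma giso1 : f 1%g = 1%g.
Proof. by apply: (mulgI (f 1%g)); rewrite -gisoM !mulg1. Qed.
Lemma gisoV x : f x^-1%g = (f x)^-1%g.
Proof. by apply: (mulgI (f x)); rewrite -gisoM !mulgV giso1. Qed.

Definition iso_biset_on : biset_on H G H.
Proof.
exists (fun h x => h * x)%g (fun x g => x * f g)%g.
- exact: mul1g.
- by move=> *; rewrite mulgA.
- by move=> x; rewrite giso1 mulg1.
- by move=> *; rewrite gisoM mulgA.
- by move=> *; rewrite mulgA.
Defined.

Definition iso_biset : biset H G := Biset iso_biset_on.
End IsoBiset.

(* Bisets on the sets 'I_n: every finite biset is isomorphic to one of these,
   and, unlike [biset H G], they form a type in the universe of [H] and [G]. *)
Record sbiset (H G : finGroupType) := SBiset {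
  sdeg : nat;
  sstr : biset_on H G 'I_sdeg
}.

Definition biset_of_sbiset H G (X : sbiset H G) : biset H G := Biset (sstr X).
Coercion biset_of_sbiset : sbiset >-> biset.

Definition skel_on H G (X : biset H G) : biset_on H G 'I_#|X|.
Proof.
exists (fun h i => enum_rank (lact X h (enum_val i)))
       (fun i g => enum_rank (ract X (enum_val i) g)).
- by move=> i; rewrite lact1 enum_valK.
- by move=> h k i; rewrite lactM enum_rankK.
- by move=> i; rewrite ract1 enum_valK.
- by move=> i h k; rewrite ractM enum_rankK.
- by move=> h i g; rewrite !enum_rankK lractA.
Defined.

Definition skel H G (X : biset H G) : sbiset H G := SBiset (skel_on X).

Lemma skel_iso H G (X : biset H G) : biset_iso (skel X) X.
Proof.
exists (fun i : 'I_#|X| => enum_val i); split.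
- by exists enum_rank; [exact: enum_valK | exact: enum_rankK].
- by move=> h i /=; rewrite enum_rankK.
- by move=> i g /=; rewrite enum_rankK.
Qed.

Section Burnside.
Variables (H G : finGroupType).

Inductive burnside_rel : term int (sbiset H G) -> term int (sbiset H G) -> Prop :=
| burnside_iso (X Y : sbiset H G) : biset_iso X Y -> burnside_rel (Tgen _ X) (Tgen _ Y)
| burnside_sum (X Y Z : sbiset H G) : biset_iso Z (bsum X Y) ->
    burnside_rel (Tgen _ Z) (Tadd (Tgen _ X) (Tgen _ Y)).

(* The Grothendieck group of finite (H,G)-bisets: the abelian group (that is,
   Z-module) generated by their isomorphism classes, with disjoint unions as
   sums. *)
Definition burnside : zmodType := presented burnside_rel.

Definition burnside_class (X : biset H G) : burnside := pgen burnside_rel (skel X).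

Definition burnside_lift (V : zmodType) (f : biset H G -> V) : burnside -> V :=
  plift (rel := burnside_rel) (fun z v => v *~ z) (fun X => f X).

Lemma burnside_class_iso X Y : biset_iso X Y -> burnside_class X = burnside_class Y.
Proof.
move=> XY; apply/pclass_eq/tc_rel/burnside_iso.
apply: biset_iso_trans (skel_iso X) _; apply: biset_iso_trans XY _.
exact/biset_iso_sym/skel_iso.
Qed.

Lemma burnside_class_sum X Y :
  burnside_class (bsum X Y) = burnside_class X + burnside_class Y.
Proof.
rewrite [RHS]pclassD; apply/pclass_eq/tc_rel/burnside_sum.
apply: biset_iso_trans (skel_iso _) _.
have [f [fb fl fr]] := biset_iso_sym (skel_iso X).
have [g [gb gl gr]] := biset_iso_sym (skel_iso Y).
have [f' fK f'K] := fb; have [g' gK g'K] := gb.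
exists (fun u : X + Y => match u with inl x => inl (f x) | inr y => inr (g y) end).
split.
- exists (fun u => match u with inl x => inl (f' x) | inr y => inr (g' y) end).
    by case=> u /=; rewrite (fK, gK).
  by case=> u /=; rewrite (f'K, g'K).
- by move=> h [] u /=; congr (_ _); [exact: fl|exact: gl].
- by move=> [] u k /=; congr (_ _); [exact: fr|exact: gr].
Qed.

Section BurnsideLift.
Variables (V : zmodType) (f : biset H G -> V).
Hypothesis fiso : forall X Y, biset_iso X Y -> f X = f Y.
Hypothesis fsum : forall X Y, f (bsum X Y) = f X + f Y.

Let frel x y : burnside_rel x y ->
  teval (fun (z : int) v => v *~ z) (fun X : sbiset H G => f X) x =
  teval (fun (z : int) v => v *~ z) (fun X : sbiset H G => f X) y.
Proof. by case=> [X Y /fiso|X Y Z /fiso] //= ->; rewrite fsum. Qed.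

Lemma burnside_liftE X : burnside_lift f (burnside_class X) = f X.
Proof.
rewrite -(fiso (skel_iso X)); apply: plift_gen => //.
- by move=> r s v; rewrite -mulrzA mulrC.
- by move=> r u v; rewrite mulrzDl.
- by move=> r s v; rewrite mulrzDr.
Qed.
Lemma burnside_liftD a b :
  burnside_lift f (a + b) = burnside_lift f a + burnside_lift f b.
Proof.
apply: plift_add => //.
- by move=> r s v; rewrite -mulrzA mulrC.
- by move=> r u v; rewrite mulrzDl.
- by move=> r s v; rewrite mulrzDr.
Qed.
End BurnsideLift.

End Burnside.

Section RBurnside.
Variables (R : comPzRingType) (H G : finGroupType).

Definition RB : lmodType R := tensorZ R (burnside H G).

Definition RB_class (X : biset H G) : RB := tensorZ_elt (1 : R) (burnside_class X).

(* the R-linear extension of a function f on bisets, when f is invariant under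
   isomorphism and sends disjoint unions to sums *)
Definition RB_lift (V : lmodType R) (f : biset H G -> V) : RB -> V :=
  tensorZ_lift (burnside_lift f).

Lemma RB_class_iso X Y : biset_iso X Y -> RB_class X = RB_class Y.
Proof. by move=> XY; rewrite /RB_class (burnside_class_iso XY). Qed.
Lemma RB_class_sum X Y : RB_class (bsum X Y) = RB_class X + RB_class Y.
Proof. by rewrite /RB_class burnside_class_sum tensorZ_eltD. Qed.

Section Lift.
Variables (V : lmodType R) (f : biset H G -> V).
Hypothesis fiso : forall X Y, biset_iso X Y -> f X = f Y.
Hypothesis fsum : forall X Y, f (bsum X Y) = f X + f Y.

Lemma RB_liftE X : RB_lift f (RB_class X) = f X.
Proof.
rewrite /RB_lift tensorZ_liftE ?scale1r ?burnside_liftE //.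
exact: burnside_liftD.
Qed.
Lemma RB_lift_linear : linear (RB_lift f).
Proof.
move=> r a b; rewrite /RB_lift tensorZ_liftD ?tensorZ_liftZ //; exact: burnside_liftD.
Qed.
End Lift.

Lemma RB_ind (P : RB -> Prop) :
  (forall X, P (RB_class X)) -> P 0 -> (forall r a b, P a -> P b -> P (r *: a + b)) ->
  forall a, P a.
Proof.
move=> Pc P0 Pl.
have PZ r a : P a -> P (r *: a) by move=> Pa; rewrite -[_ *: _]addr0; apply: Pl.
have PD a b : P a -> P b -> P (a + b).
  by move=> Pa Pb; rewrite -[a]scale1r; apply: Pl.
have PN a : P a -> P (- a) by move=> /(PZ (-1)); rewrite scaleN1r.
apply: presented_ind => //= -[r x]; rewrite -/(tensorZ_elt r x) tensorZ_eltZ.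
apply: PZ; move: x; apply: presented_ind.
- move=> X; rewrite -(_ : burnside_class X = pgen _ X); first exact: Pc.
  by apply/pclass_eq/tc_rel/burnside_iso/skel_iso.
- rewrite (_ : tensorZ_elt (1 : R) 0 = 0) //.
  by apply: (addrI (tensorZ_elt (1 : R) 0)); rewrite -tensorZ_eltD !addr0.
- move=> a Pa; rewrite (_ : tensorZ_elt (1 : R) (- a) = - tensorZ_elt (1 : R) a); first exact: PN.
  apply/eqP; rewrite -addr_eq0 -tensorZ_eltD addNr.
  by apply/eqP/(addrI (tensorZ_elt (1 : R) 0)); rewrite -tensorZ_eltD !addr0.
- by move=> a b Pa Pb; rewrite tensorZ_eltD; apply: PD.
- move=> z a Pa.
  have E : forall n : nat, P (tensorZ_elt (1 : R) (a *+ n)).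
    elim=> [|n IH]; last by rewrite mulrS tensorZ_eltD; apply: PD.
    rewrite mulr0n (_ : tensorZ_elt (1 : R) 0 = 0) //.
    by apply: (addrI (tensorZ_elt (1 : R) 0)); rewrite -tensorZ_eltD !addr0.
  have -> : z *: a = a *~ z by rewrite -[in LHS](intz z) scaler_int.
  case: z => n; first exact: E.
  rewrite NegzE mulrNz (_ : tensorZ_elt (1 : R) (- (a *~ n.+1)) = - tensorZ_elt (1 : R) (a *+ n.+1)).
    exact/PN/E.
  apply/eqP; rewrite -addr_eq0 -tensorZ_eltD addNr.
  by apply/eqP/(addrI (tensorZ_elt (1 : R) 0)); rewrite -tensorZ_eltD !addr0.
Qed.

Lemma linear_at0 (V W : lmodType R) (f : V -> W) : linear f -> f 0 = 0.
Proof. by move=> fl; have := fl (-1) 0 0; rewrite !scaleN1r !addNr. Qed.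

Lemma RB_linear_ext (V : lmodType R) (f g : RB -> V) : linear f -> linear g ->
  (forall X, f (RB_class X) = g (RB_class X)) -> forall a, f a = g a.
Proof.
move=> fl gl fg; apply: RB_ind => //; first by rewrite !linear_at0.
by move=> r a b fa fb; rewrite fl gl fa fb.
Qed.
End RBurnside.

Arguments RB_class R {H G} X.

Section Composition.
Variables (R : comPzRingType) (K H G : finGroupType).

Lemma btens_iso (V V' : biset K H) (U U' : biset H G) :
  biset_iso V V' -> biset_iso U U' -> biset_iso (btens V U) (btens V' U').
Proof.
case=> a [[a' aK a'K] al ar] [b [[b' bK b'K] bl br]].
apply: (@btens_iso_intro _ _ _ _ _ (btens V' U') (fun p => tens_pi (a p.1, b p.2))).
- move=> [v u] [v' u']; apply: (iff_trans (tens_piP _ _)).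
  split=> /existsP[h /eqP[/= E1 E2]]; apply/existsP; exists h; apply/eqP => /=.
    by congr pair; [rewrite -[v']aK E1 -ar aK | rewrite -[u']bK E2 -bl bK].
  by rewrite E1 E2 ar bl.
- move=> S; exists (a' (tens_rep S).1, b' (tens_rep S).2).
  by rewrite /= a'K b'K -surjective_pairing tens_repK.
- by move=> k v u /=; rewrite tens_lE /= al.
- by move=> v u g /=; rewrite tens_rE /= br.
Qed.

Lemma btens_suml (V V' : biset K H) (U : biset H G) :
  biset_iso (btens (bsum V V') U) (bsum (btens V U) (btens V' U)).
Proof.
apply: (@btens_iso_intro _ _ _ (bsum V V') U (bsum (btens V U) (btens V' U))
  (fun p => match p.1 with inl v => inl (tens_pi (v, p.2))
                         | inr v => inr (tens_pi (v, p.2)) end)).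
- move=> [v u] [v' u']; split=> /=.
    case: v v' => v [] v' // [] /setP/(_ (v', u')); rewrite !inE tens_rel_refl;
      by case/existsP=> h /eqP[/= -> ->]; apply/existsP; exists h.
  case/existsP=> h /eqP[/= -> ->]; case: v => v /=;
  by congr (_ _); apply/tens_piP/existsP; exists h.
- by case=> S; [exists (inl (tens_rep S).1, (tens_rep S).2)
               | exists (inr (tens_rep S).1, (tens_rep S).2)];
     rewrite /= -surjective_pairing tens_repK.
- by move=> k [] v u /=; rewrite tens_lE.
- by move=> [] v u g /=; rewrite tens_rE.
Qed.

Lemma btens_sumr (V : biset K H) (U U' : biset H G) :
  biset_iso (btens V (bsum U U')) (bsum (btens V U) (btens V U')).
Proof.
apply: (@btens_iso_intro _ _ _ V (bsum U U') (bsum (btens V U) (btens V U'))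
  (fun p => match p.2 with inl u => inl (tens_pi (p.1, u))
                         | inr u => inr (tens_pi (p.1, u)) end)).
- move=> [v u] [v' u']; split=> /=.
    case: u u' => u [] u' // [] /setP/(_ (v', u')); rewrite !inE tens_rel_refl;
      by case/existsP=> h /eqP[/= -> ->]; apply/existsP; exists h.
  case/existsP=> h /eqP[/= -> ->]; case: u => u /=;
  by congr (_ _); apply/tens_piP/existsP; exists h.
- by case=> S; [exists ((tens_rep S).1, inl (tens_rep S).2)
               | exists ((tens_rep S).1, inr (tens_rep S).2)];
     rewrite /= -surjective_pairing tens_repK.
- by move=> k v [] u /=; rewrite tens_lE.
- by move=> v [] u g /=; rewrite tens_rE.
Qed.

Definition RBcomp (v : RB R K H) (u : RB R H G) : RB R K G :=
  RB_lift (fun V => RB_lift (fun U => RB_class R (btens V U)) u) v.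

Let comp1 V (u : RB R H G) : RB R K G := RB_lift (fun U => RB_class R (btens V U)) u.

Let comp1_linear V : linear (comp1 V).
Proof.
apply: RB_lift_linear => [U U' UU'|U U'].
  by apply: RB_class_iso; apply: btens_iso => //; apply: biset_iso_refl.
by rewrite (RB_class_iso _ (btens_sumr _ _ _)) RB_class_sum.
Qed.
Let comp1E V U : comp1 V (RB_class R U) = RB_class R (btens V U).
Proof.
apply: RB_liftE => [U' U'' UU'|U' U''].
  by apply: RB_class_iso; apply: btens_iso => //; apply: biset_iso_refl.
by rewrite (RB_class_iso _ (btens_sumr _ _ _)) RB_class_sum.
Qed.
Let comp1_iso V V' u : biset_iso V V' -> comp1 V u = comp1 V' u.
Proof.
move=> VV'; move: u; apply: RB_linear_ext; try exact: comp1_linear.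
move=> U; rewrite !comp1E; apply: RB_class_iso; apply: btens_iso => //.
exact: biset_iso_refl.
Qed.
Let comp1_sum V V' u : comp1 (bsum V V') u = comp1 V u + comp1 V' u.
Proof.
move: u; apply: RB_linear_ext; first exact: comp1_linear.
  by move=> r a b; rewrite !comp1_linear scalerDr addrACA.
by move=> U; rewrite !comp1E (RB_class_iso _ (btens_suml _ _ _)) RB_class_sum.
Qed.

Lemma RBcomp_linearl u : linear (RBcomp^~ u).
Proof. by apply: RB_lift_linear => V V'; [exact: comp1_iso|exact: comp1_sum]. Qed.
Let RBcomp_comp1 V u : RBcomp (RB_class R V) u = comp1 V u.
Proof. by apply: RB_liftE => V' V''; [exact: comp1_iso|exact: comp1_sum]. Qed.
Lemma RBcomp_linearr v : linear (RBcomp v).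
Proof.
move=> r a b; move: v; apply: RB_ind => [V||s v v' IH IH'].
- by rewrite !RBcomp_comp1 comp1_linear.
- by rewrite !(linear_at0 (RBcomp_linearl _)) scaler0 addr0.
rewrite !RBcomp_linearl IH IH' !scalerDr !scalerA [s * r]mulrC -!addrA.
by congr (_ + _); rewrite addrCA.
Qed.
Lemma RBcompE V U : RBcomp (RB_class R V) (RB_class R U) = RB_class R (btens V U).
Proof. by rewrite RBcomp_comp1 comp1E. Qed.
End Composition.

Section Product.
Variables (R : comPzRingType) (H G H' G' : finGroupType).

Lemma bprod_iso (X Y : biset H G) (X' Y' : biset H' G') :
  biset_iso X Y -> biset_iso X' Y' -> biset_iso (bprod X X') (bprod Y Y').
Proof.
case=> a [[a' aK a'K] al ar] [b [[b' bK b'K] bl br]].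
exists (fun p => (a p.1, b p.2)); split.
- by exists (fun p => (a' p.1, b' p.2)) => -[x y] /=; rewrite ?aK ?bK ?a'K ?b'K.
- by move=> h [x y] /=; congr pair; [exact: al|exact: bl].
- by move=> [x y] g /=; congr pair; [exact: ar|exact: br].
Qed.

Lemma bprod_suml (X Y : biset H G) (X' : biset H' G') :
  biset_iso (bprod (bsum X Y) X') (bsum (bprod X X') (bprod Y X')).
Proof.
exists (fun p => match p.1 with inl x => inl (x, p.2) | inr y => inr (y, p.2) end).
split.
- exists (fun p => match p with inl q => (inl q.1, q.2) | inr q => (inr q.1, q.2) end).
    by case=> [[?|?] ?].
  by case=> [[? ?]|[? ?]].
- by move=> h [[x|x] y].
- by move=> [[x|x] y] g.
Qed.

Lemma bprod_sumr (X : biset H G) (X' Y' : biset H' G') :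
  biset_iso (bprod X (bsum X' Y')) (bsum (bprod X X') (bprod X Y')).
Proof.
exists (fun p => match p.2 with inl x => inl (p.1, x) | inr y => inr (p.1, y) end).
split.
- exists (fun p => match p with inl q => (q.1, inl q.2) | inr q => (q.1, inr q.2) end).
    by case=> ? [?|?].
  by case=> [[? ?]|[? ?]].
- by move=> h [x [y|y]].
- by move=> [x [y|y]] g.
Qed.

Definition RBprod (x : RB R H G) (y : RB R H' G') : RB R (H * H')%type (G * G')%type :=
  RB_lift (fun X => RB_lift (fun Y => RB_class R (bprod X Y)) y) x.

Let prod1 X (y : RB R H' G') : RB R (H * H')%type (G * G')%type :=
  RB_lift (fun Y => RB_class R (bprod X Y)) y.

Let prod1_linear X : linear (prod1 X).
Proof.
apply: RB_lift_linear => [U U' UU'|U U'].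
  by apply: RB_class_iso; apply: bprod_iso => //; apply: biset_iso_refl.
by rewrite (RB_class_iso _ (bprod_sumr _ _ _)) RB_class_sum.
Qed.
Let prod1E X Y : prod1 X (RB_class R Y) = RB_class R (bprod X Y).
Proof.
apply: RB_liftE => [U U' UU'|U U'].
  by apply: RB_class_iso; apply: bprod_iso => //; apply: biset_iso_refl.
by rewrite (RB_class_iso _ (bprod_sumr _ _ _)) RB_class_sum.
Qed.
Let prod1_iso X X' y : biset_iso X X' -> prod1 X y = prod1 X' y.
Proof.
move=> XX'; move: y; apply: RB_linear_ext; try exact: prod1_linear.
move=> Y; rewrite !prod1E; apply: RB_class_iso; apply: bprod_iso => //.
exact: biset_iso_refl.
Qed.
Let prod1_sum X X' y : prod1 (bsum X X') y = prod1 X y + prod1 X' y.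
Proof.
move: y; apply: RB_linear_ext; first exact: prod1_linear.
  by move=> r a b; rewrite !prod1_linear scalerDr addrACA.
by move=> U; rewrite !prod1E (RB_class_iso _ (bprod_suml _ _ _)) RB_class_sum.
Qed.

Lemma RBprod_linearl y : linear (RBprod^~ y).
Proof. by apply: RB_lift_linear => X X'; [exact: prod1_iso|exact: prod1_sum]. Qed.
Let RBprod_prod1 X y : RBprod (RB_class R X) y = prod1 X y.
Proof. by apply: RB_liftE => X' X''; [exact: prod1_iso|exact: prod1_sum]. Qed.
Lemma RBprod_linearr x : linear (RBprod x).
Proof.
move=> r a b; move: x; apply: RB_ind => [X||s v v' IH IH'].
- by rewrite !RBprod_prod1 prod1_linear.
- by rewrite !(linear_at0 (RBprod_linearl _)) scaler0 addr0.
rewrite !RBprod_linearl IH IH' !scalerDr !scalerA [s * r]mulrC -!addrA.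
by congr (_ + _); rewrite addrCA.
Qed.
Lemma RBprodE X Y : RBprod (RB_class R X) (RB_class R Y) = RB_class R (bprod X Y).
Proof. by rewrite RBprod_prod1 prod1E. Qed.
End Product.

Section UnitGroup.
Definition unit_mulg (_ _ : unit) := tt.
Definition unit_invg (_ : unit) := tt.
Let mA : associative unit_mulg. Proof. by []. Qed.
Let m1 : left_id tt unit_mulg. Proof. by case. Qed.
Let mV : left_inverse tt unit_invg unit_mulg. Proof. by []. Qed.
HB.instance Definition _ := Finite_isGroup.Build unit mA m1 mV.
End UnitGroup.

Section CanonicalIsos.
Variables (G H K G' H' : finGroupType).

Definition giso_id : giso G G.
Proof. by exists id => //; exists id. Defined.

Definition giso_comp (f : giso H K) (g : giso G H) : giso G K.
Proof.
exists (f \o g); first by move=> x y /=; rewrite !gisoM.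
by apply: bij_comp; apply: giso_bij.
Defined.

Definition giso_prod (f : giso G H) (g : giso G' H') : giso (G * G')%type (H * H')%type.
Proof.
exists (fun p => (f p.1, g p.2)); first by move=> [x x'] [y y']; congr pair; exact: gisoM.
have [a aK a'K] := giso_bij f; have [b bK b'K] := giso_bij g.
by exists (fun p => (a p.1, b p.2)) => -[x y] /=; rewrite ?aK ?bK ?a'K ?b'K.
Defined.

Definition giso_assoc : giso (G * H * K)%type (G * (H * K))%type.
Proof.
exists (fun p => (p.1.1, (p.1.2, p.2))) => //.
by exists (fun p => (p.1, p.2.1, p.2.2)) => [[[]]|[? []]].
Defined.

Definition giso_assocV : giso (G * (H * K))%type (G * H * K)%type.
Proof.
exists (fun p => (p.1, p.2.1, p.2.2)) => //.
by exists (fun p => (p.1.1, (p.1.2, p.2))) => [[? []]|[[]]].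
Defined.

Definition giso_swap : giso (G * H)%type (H * G)%type.
Proof.
exists (fun p => (p.2, p.1)) => //.
by exists (fun p => (p.2, p.1)) => -[].
Defined.

Definition giso_unitl : giso (unit * G)%type G.
Proof.
exists snd => //.
by exists (pair tt) => // -[[]].
Defined.

Definition giso_unitr : giso (G * unit)%type G.
Proof.
exists fst => //.
by exists (fun x => (x, tt)) => // -[? []].
Defined.

End CanonicalIsos.

Section RBIso.
Variable R : comPzRingType.

Definition RBiso (G H : finGroupType) (f : giso G H) : RB R H G :=
  RB_class R (iso_biset f).

(* the identity morphism of G: the class of the (G,G)-biset G *)
Definition RBid (G : finGroupType) : RB R G G := RBiso (giso_id G).

Lemma RBiso_ext G H (f g : giso G H) : f =1 g -> RBiso f = RBiso g.
Proof.
move=> fg; apply: RB_class_iso; exists id; split=> //; first by exists id.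
by move=> x k /=; rewrite fg.
Qed.

Lemma RBcomp_isol G H H' (f : giso H H') (U : biset H G) (W : biset H' G) :
  biset_iso_along f id U W -> RBcomp (RBiso f) (RB_class R U) = RB_class R W.
Proof.
case=> phi [[psi phiK psiK] pl pr]; rewrite RBcompE; apply: RB_class_iso.
apply: (@btens_iso_intro _ _ _ (iso_biset f) U W (fun p => lact W p.1 (phi p.2))).
- move=> [x u] [x' u']; split=> /=.
    move=> E; have [a aK a'K] := giso_bij f.
    have Eh : f (a (x^-1 * x')%g) = (x^-1 * x')%g by rewrite a'K.
    apply/existsP; exists (a (x^-1 * x')%g); apply/eqP => /=; congr pair.
      by rewrite Eh mulgA mulgV mul1g.
    rewrite -[u']phiK -[RHS]phiK; congr psi.
    rewrite pl gisoV Eh invMg invgK lactM E -lactM mulVg.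
    by rewrite lact1.
  case/existsP=> h /eqP[/= -> ->].
  by rewrite pl -lactM -mulgA -gisoM mulgV giso1 mulg1.
- by move=> w; exists (1%g, psi w); rewrite /= lact1 psiK.
- by move=> k x u /=; rewrite lactM.
- by move=> x u g /=; rewrite pr lractA.
Qed.

Lemma RBcomp_isor G H K (f : giso G H) (V : biset K H) (W : biset K G) :
  biset_iso_along id f W V -> RBcomp (RB_class R V) (RBiso f) = RB_class R W.
Proof.
case=> phi [[psi phiK psiK] pl pr]; rewrite RBcompE; apply: RB_class_iso.
apply: (@btens_iso_intro _ _ _ V (iso_biset f) W (fun p => psi (ract V p.1 p.2))).
- move=> [v x] [v' x']; split=> /=.
    move=> /(congr1 phi); rewrite !psiK => E.
    apply/existsP; exists (x * x'^-1)%g; apply/eqP => /=.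
    by rewrite ractM E -ractM mulgV ract1 invMg invgK -mulgA mulVg mulg1.
  by case/existsP=> h /eqP[/= -> ->]; rewrite -ractM mulgA mulgV mul1g.
- by move=> w; exists (phi w, 1%g); rewrite /= ract1 phiK.
- by move=> k v x /=; rewrite -[RHS]phiK pl psiK -lractA.
- by move=> v x g /=; rewrite -[RHS]phiK pr psiK ractM.
Qed.

Lemma RBiso_comp G H K (f : giso H K) (g : giso G H) :
  RBcomp (RBiso f) (RBiso g) = RBiso (giso_comp f g).
Proof.
apply: RBcomp_isol; exists f; split; first exact: giso_bij.
- by move=> h x /=; rewrite gisoM.
- by move=> x k /=; rewrite gisoM.
Qed.

Lemma RBiso_prod G H G' H' (f : giso G H) (g : giso G' H') :
  RBprod (RBiso f) (RBiso g) = RBiso (giso_prod f g).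
Proof.
rewrite RBprodE; apply: RB_class_iso; exists id; split=> //; first by exists id.
Qed.

Section UnitTwist.
Variables (G H : finGroupType) (U : biset H G).
Definition unit_twist_on : biset_on H (unit * G)%type U.
Proof.
exists (lact U) (fun x (g : unit * G) => ract U x g.2).
- exact: lact1.
- exact: lactM.
- exact: ract1.
- by move=> x g k; exact: ractM.
- by move=> *; exact: lractA.
Defined.
Definition unit_twist : biset H (unit * G)%type := Biset unit_twist_on.
End UnitTwist.

Lemma RBiso_unitl_nat G H (phi : RB R H G) :
  RBcomp (RBiso (giso_unitl H)) (RBprod (RBid unit) phi) =
  RBcomp phi (RBiso (giso_unitl G)).
Proof.
move: phi; apply: RB_linear_ext.
- by move=> r a b; rewrite RBprod_linearr RBcomp_linearr.
- by move=> r a b; rewrite RBcomp_linearl.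
move=> U; rewrite RBprodE.
rewrite (@RBcomp_isol _ _ _ _ _ (unit_twist U)).
  rewrite (@RBcomp_isor _ _ _ _ _ (unit_twist U)) //.
  by exists id; split=> //; exists id.
exists snd; split.
- by exists (pair tt) => // -[[]].
- by [].
- by [].
Qed.

End RBIso.

Lemma btens_assoc (L K H G : finGroupType) (W : biset L K) (V : biset K H) (U : biset H G) :
  biset_iso (btens (btens W V) U) (btens W (btens V U)).
Proof.
pose f (p : btens W V * U) : btens W (btens V U) :=
  tens_pi ((tens_rep p.1).1, tens_pi ((tens_rep p.1).2, p.2) : btens V U).
have fE w v u : f (tens_pi (w, v), u) = tens_pi (w, tens_pi (v, u) : btens V U).
  have /tens_rel_sym/existsP[k /eqP /= E] := tens_pi_rep (w, v).
  rewrite /f /= E /= tens_pi_mid /= tens_lE /=.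
  by rewrite -lactM mulgV lact1.
apply: (@btens_iso_intro _ _ _ (btens W V) U (btens W (btens V U)) f).
- move=> [S u] [S' u']; rewrite -[S]tens_repK -[S']tens_repK.
  case: (tens_rep S) (tens_rep S') => w v [w' v']; rewrite !fE; split.
    case/tens_piP/existsP=> k; rewrite xpair_eqE => /andP[/eqP/= -> /eqP/=].
    rewrite tens_lE => /esym/tens_piP/existsP[h /eqP[/= -> ->]].
    apply/existsP; exists h; apply/eqP; congr pair; rewrite /= tens_rE /=.
    by rewrite -lractA tens_pi_mid -lactM mulgV lact1.
  case/existsP=> h; rewrite xpair_eqE => /andP[/eqP/= + /eqP/= ->].
  rewrite tens_rE /= => E.
  rewrite -!fE E !fE.
  by rewrite tens_pi_mid -lactM mulgV lact1.
- move=> S; exists (tens_pi ((tens_rep S).1, (tens_rep (tens_rep S).2).1),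
                    (tens_rep (tens_rep S).2).2).
  rewrite fE -surjective_pairing tens_repK.
  by rewrite -surjective_pairing tens_repK.
- move=> k S u; rewrite -[S]tens_repK; case: (tens_rep S) => w v.
  by rewrite /= tens_lE /= !fE tens_lE.
- move=> S u g; rewrite -[S]tens_repK; case: (tens_rep S) => w v.
  by rewrite !fE /= tens_rE /= tens_rE.
Qed.

Lemma RBcompA (R : comPzRingType) (L K H G : finGroupType)
    (w : RB R L K) (v : RB R K H) (u : RB R H G) :
  RBcomp w (RBcomp v u) = RBcomp (RBcomp w v) u.
Proof.
move: w; apply: RB_linear_ext => [||W].
- exact: RBcomp_linearl.
- by move=> r a b; rewrite !RBcomp_linearl.
move: v; apply: RB_linear_ext => [||V].
- by move=> r a b; rewrite RBcomp_linearl RBcomp_linearr.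
- by move=> r a b; rewrite RBcomp_linearr RBcomp_linearl.
move: u; apply: RB_linear_ext => [||U].
- by move=> r a b; rewrite !RBcomp_linearr.
- exact: RBcomp_linearr.
by rewrite !RBcompE; apply/esym/RB_class_iso/btens_assoc.
Qed.

Lemma RBcomp1l (R : comPzRingType) (H G : finGroupType) (u : RB R H G) :
  RBcomp (RBid R H) u = u.
Proof.
move: u; apply: RB_linear_ext => [||U] //; first exact: RBcomp_linearr.
exact/RBcomp_isol/biset_iso_refl.
Qed.

Lemma RBcomp1r (R : comPzRingType) (H G : finGroupType) (u : RB R H G) :
  RBcomp u (RBid R G) = u.
Proof.
move: u; apply: RB_linear_ext => [||U] //; first exact: RBcomp_linearl.
exact/RBcomp_isor/biset_iso_refl.
Qed.

Record group_class := GroupClass {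
  gc_mem :> finGroupType -> Prop;
  gc_nonempty : exists G, gc_mem G;
  gc_subquotient : forall (G Q : finGroupType) (H N : {group G}),
    gc_mem G -> (N <| H)%g -> ([set: Q] \isog H / N)%g -> gc_mem Q;
  gc_prod : forall G H : finGroupType, gc_mem G -> gc_mem H -> gc_mem (G * H)%type
}.

Record dgroup (D : group_class) := DGroup {
  dgroup_sort :> finGroupType;
  dgroup_mem : D dgroup_sort
}.

Section DGroups.
Variable D : group_class.

Lemma gc_unit : D unit.
Proof.
have [G DG] := gc_nonempty D.
apply: (@gc_subquotient D G unit 1%G 1%G DG); first exact: normal_refl.
apply: trivial_isog; last exact: trivg_quotient.
by apply/setP=> -[]; rewrite !inE; apply/esym/eqP.
Qed.

Definition dunit : dgroup D := DGroup gc_unit.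
Definition dgprod (G H : dgroup D) : dgroup D :=
  DGroup (gc_prod (dgroup_mem G) (dgroup_mem H)).

Section Isos.
Variables G H K G' H' : dgroup D.
Definition d_assoc : giso (dgprod (dgprod G H) K) (dgprod G (dgprod H K)) :=
  giso_assoc G H K.
Definition d_assocV : giso (dgprod G (dgprod H K)) (dgprod (dgprod G H) K) :=
  giso_assocV G H K.
Definition d_swap : giso (dgprod G H) (dgprod H G) := giso_swap G H.
Definition d_unitl : giso (dgprod dunit G) G := giso_unitl G.
Definition d_unitr : giso (dgprod G dunit) G := giso_unitr G.
Definition d_prod (f : giso G H) (g : giso G' H') :
  giso (dgprod G G') (dgprod H H') := giso_prod f g.
End Isos.
End DGroups.

Arguments dunit {D}.

Record category := Category {
  ob :> Type;
  hom : ob -> ob -> Type;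
  idc : forall x, hom x x;
  compc : forall x y z, hom y z -> hom x y -> hom x z;
  compcA : forall x y z t (h : hom z t) (g : hom y z) (f : hom x y),
    compc h (compc g f) = compc (compc h g) f;
  compc1l : forall x y (f : hom x y), compc (idc y) f = f;
  compc1r : forall x y (f : hom x y), compc f (idc x) = f
}.

Definition isoc (C : category) (x y : C) : Prop :=
  exists (f : hom x y) (g : hom y x), compc g f = idc x /\ compc f g = idc y.

Record functor (C D : category) := Functor {
  fob :> C -> D;
  fmap : forall x y, hom x y -> hom (fob x) (fob y);
  fmap1 : forall x, fmap (idc x) = idc (fob x);
  fmapM : forall x y z (g : hom y z) (f : hom x y),
    fmap (compc g f) = compc (fmap g) (fmap f)
}.

Definition functor_id (C : category) : functor C C.
Proof. by exists id (fun x y f => f). Defined.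

Definition functor_comp (C D E : category) (G : functor D E) (F : functor C D) :
  functor C E.
Proof.
exists (fun x => G (F x)) (fun x y f => fmap G (fmap F f)).
- by move=> x; rewrite !fmap1.
- by move=> x y z g f; rewrite !fmapM.
Defined.

Definition nat_iso (C D : category) (F G : functor C D) : Prop :=
  exists (a : forall x, hom (F x) (G x)) (b : forall x, hom (G x) (F x)),
    (forall x y (f : hom x y), compc (fmap G f) (a x) = compc (a y) (fmap F f)) /\
    (forall x, compc (b x) (a x) = idc (F x) /\ compc (a x) (b x) = idc (G x)).

Definition equivalent_categories (C D : category) : Prop :=
  exists (F : functor C D) (G : functor D C),
    nat_iso (functor_comp G F) (functor_id C) /\
    nat_iso (functor_comp F G) (functor_id D).

Definition product_category (I : Type) (C : I -> category) : category.
Proof.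
exists (forall i, C i) (fun x y => forall i, hom (x i) (y i))
  (fun x i => idc (x i)) (fun x y z g f i => compc (g i) (f i)).
- by move=> x y z t h g f; apply: functional_extensionality_dep => i; apply: compcA.
- by move=> x y f; apply: functional_extensionality_dep => i; apply: compc1l.
- by move=> x y f; apply: functional_extensionality_dep => i; apply: compc1r.
Defined.

Definition biset_category (R : comPzRingType) (D : group_class) : category.
Proof.
by exists (dgroup D) (fun G H => RB R H G) (fun G => RBid R G)
  (fun G H K (psi : RB R K H) (phi : RB R H G) => RBcomp psi phi) => *;
  [apply: RBcompA | apply: RBcomp1l | apply: RBcomp1r].
Defined.

Section GreenFunctors.
Variables (R : comPzRingType) (D : group_class).
Implicit Types G H K L : dgroup D.

(* R-linear functors from [biset_category R D] to R-Mod. *)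
Record bfunctor := BFunctor {
  bf_obj :> dgroup D -> lmodType R;
  bf_map : forall G H, RB R H G -> bf_obj G -> bf_obj H;
  bf_map_linear : forall G H (phi : RB R H G), linear (bf_map phi);
  bf_mor_linear : forall G H (x : bf_obj G),
    linear (fun phi : RB R H G => bf_map phi x);
  bf_id : forall G (x : bf_obj G), bf_map (RBid R G) x = x;
  bf_comp : forall G H K (psi : RB R K H) (phi : RB R H G) x,
    bf_map (RBcomp psi phi) x = bf_map psi (bf_map phi x)
}.

Definition bf_iso (F : bfunctor) G H (f : giso G H) : F G -> F H :=
  bf_map (RBiso R f).

Record green := Green {
  gr_fun :> bfunctor;
  gr_mul : forall G H, gr_fun G -> gr_fun H -> gr_fun (dgprod G H);
  gr_one : gr_fun dunit;
  gr_linearl : forall G H (b : gr_fun H),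
    linear (fun a : gr_fun G => gr_mul a b);
  gr_linearr : forall G H (a : gr_fun G),
    linear (fun b : gr_fun H => gr_mul a b);
  gr_assoc : forall G H K (a : gr_fun G) (b : gr_fun H) (c : gr_fun K),
    bf_iso (d_assoc G H K) (gr_mul (gr_mul a b) c) = gr_mul a (gr_mul b c);
  gr_unitl : forall G (a : gr_fun G),
    bf_iso (d_unitl G) (gr_mul gr_one a) = a;
  gr_unitr : forall G (a : gr_fun G),
    bf_iso (d_unitr G) (gr_mul a gr_one) = a;
  gr_nat : forall G G' H H' (phi : RB R G' G) (psi : RB R H' H)
      (a : gr_fun G) (b : gr_fun H),
    bf_map (RBprod phi psi : RB R (dgprod G' H') (dgprod G H)) (gr_mul a b) =
    gr_mul (bf_map phi a) (bf_map psi b)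
}.

Record gmodule (A : green) := GModule {
  gm_fun :> bfunctor;
  gm_act : forall G H, A G -> gm_fun H -> gm_fun (dgprod G H);
  gm_linearl : forall G H (m : gm_fun H), linear (fun a : A G => gm_act a m);
  gm_linearr : forall G H (a : A G), linear (fun m : gm_fun H => gm_act a m);
  gm_assoc : forall G H K (a : A G) (b : A H) (m : gm_fun K),
    bf_iso (d_assoc G H K) (gm_act (gr_mul a b) m) = gm_act a (gm_act b m);
  gm_unit : forall G (m : gm_fun G),
    bf_iso (d_unitl G) (gm_act (gr_one A) m) = m;
  gm_nat : forall G G' H H' (phi : RB R G' G) (psi : RB R H' H)
      (a : A G) (m : gm_fun H),
    bf_map (RBprod phi psi : RB R (dgprod G' H') (dgprod G H)) (gm_act a m) =
    gm_act (bf_map phi a) (bf_map psi m)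
}.

Definition regular (A : green) : gmodule A :=
  GModule (@gr_linearl A) (@gr_linearr A) (@gr_assoc A) (@gr_unitl A) (@gr_nat A).

Record gmod_hom (A : green) (M N : gmodule A) := GModHom {
  gh_fun :> forall G, M G -> N G;
  gh_linear : forall G, linear (@gh_fun G);
  gh_nat : forall G H (phi : RB R H G) (m : M G),
    gh_fun (bf_map phi m) = bf_map phi (gh_fun m);
  gh_act : forall G H (a : A G) (m : M H), gh_fun (gm_act a m) = gm_act a (gh_fun m)
}.

Lemma gmod_hom_ext (A : green) (M N : gmodule A) (f g : gmod_hom M N) :
  (forall G (m : M G), f G m = g G m) -> f = g.
Proof.
case: f g => f f1 f2 f3 [g g1 g2 g3] /= fg.
have E : f = g by apply: functional_extensionality_dep => G; apply: funext => m; apply: fg.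
by case: g / E g1 g2 g3 {fg} => g1 g2 g3; congr GModHom; apply: Prop_irrelevance.
Qed.

Section Canonical.
Variable F : bfunctor.

Lemma bf_isoM G H K (f : giso H K) (g : giso G H) (x : F G) :
  bf_iso f (bf_iso g x) = bf_iso (giso_comp f g) x.
Proof. by rewrite /bf_iso -bf_comp RBiso_comp. Qed.
Lemma bf_iso_ext G H (f g : giso G H) (x : F G) : f =1 g -> bf_iso f x = bf_iso g x.
Proof. by move=> fg; rewrite /bf_iso (RBiso_ext _ fg). Qed.
Lemma bf_iso1 G (f : giso G G) (x : F G) : f =1 id -> bf_iso f x = x.
Proof. by move=> f1; rewrite (@bf_iso_ext _ _ _ (giso_id G)) // /bf_iso bf_id. Qed.
End Canonical.

Section ModuleLemmas.
Variables (A : green) (M : gmodule A).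

Lemma gm_iso G G' H H' (f : giso G G') (g : giso H H') (a : A G) (m : M H) :
  gm_act (bf_iso f a) (bf_iso g m) =
  bf_iso (d_prod f g) (gm_act a m).
Proof. by rewrite /bf_iso -gm_nat RBiso_prod. Qed.
Lemma gm_isol G G' H (f : giso G G') (a : A G) (m : M H) :
  gm_act (bf_iso f a) m =
  bf_iso (d_prod f (giso_id H)) (gm_act a m).
Proof. by rewrite -gm_iso; congr gm_act; rewrite bf_iso1. Qed.
Lemma gm_isor G H H' (g : giso H H') (a : A G) (m : M H) :
  gm_act a (bf_iso g m) =
  bf_iso (d_prod (giso_id G) g) (gm_act a m).
Proof. by rewrite -gm_iso; congr gm_act; rewrite bf_iso1. Qed.

(* e . m, i.e. e x m in M(H), for e in A(1), identifying 1 x H with H *)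
Definition edot H (e : A dunit) (m : M H) : M H :=
  bf_iso (d_unitl H) (gm_act e m).

Lemma edot_linearl H (m : M H) : linear (fun e => edot e m).
Proof. by move=> r a b; rewrite /edot gm_linearl /bf_iso bf_map_linear. Qed.
Lemma edot_linearr H e : linear (@edot H e).
Proof. by move=> r a b; rewrite /edot gm_linearr /bf_iso bf_map_linear. Qed.

Lemma edot_nat G H (phi : RB R H G) e (m : M G) :
  bf_map phi (edot e m) = edot e (bf_map phi m).
Proof.
rewrite /edot /bf_iso -bf_comp -[e in RHS]bf_id -gm_nat -[RHS]bf_comp.
by congr bf_map; rewrite -RBiso_unitl_nat.
Qed.
End ModuleLemmas.

Arguments edot {A M H} e m.

Lemma edot_edot (A : green) (M : gmodule A) H (e e' : A dunit) (m : M H) :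
  edot e (edot e' m) = edot (edot (M := regular A) e e') m.
Proof.
rewrite /edot gm_isor bf_isoM -gm_assoc bf_isoM gm_isol bf_isoM.
by apply: bf_iso_ext => -[[[] []] x].
Qed.

Definition commutant (A : green) G (a : A G) : Prop :=
  forall H (b : A H),
    gr_mul a b = bf_iso (d_swap H G) (gr_mul b a).

(* A(1) as a ring: a b is the image of a x b under 1 x 1 = 1. *)
Definition green1 (A : green) : Type := A dunit.

HB.instance Definition _ (A : green) := GRing.Zmodule.on (green1 A).

Section Green1.
Variable A : green.

Definition green1_mul (a b : green1 A) : green1 A := edot (M := regular A) a b.
Definition green1_one : green1 A := gr_one A.

Let mA : associative green1_mul.
Proof. by move=> a b c; rewrite /green1_mul edot_edot. Qed.
Let m1 : left_id green1_one green1_mul.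
Proof. by move=> a; apply: gr_unitl. Qed.
Let mr1 : right_id green1_one green1_mul.
Proof.
move=> a; rewrite -[RHS]gr_unitr; apply: bf_iso_ext.
by case=> [[] []].
Qed.
Let mDl : left_distributive green1_mul +%R.
Proof.
move=> a b c; have := edot_linearl (M := regular A) (c : A dunit) 1 a b.
by rewrite !scale1r.
Qed.
Let mDr : right_distributive green1_mul +%R.
Proof.
move=> a b c; have := edot_linearr (M := regular A) (a : A dunit) 1 b c.
by rewrite !scale1r.
Qed.
HB.instance Definition _ :=
  GRing.Zmodule_isPzRing.Build (green1 A) mA m1 mr1 mDl mDr.
End Green1.
End GreenFunctors.

Section Commutant.
Variables (R : comPzRingType) (D : group_class) (A : green R D).
Implicit Types G H K L : dgroup D.

Lemma giso_inverse (G H : finGroupType) (f : giso G H) :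
  exists g : giso H G, cancel f g /\ cancel g f.
Proof.
have [g fK gK] := giso_bij f.
have gM : {morph g : x y / (x * y)%g}.
  by move=> x y; rewrite -{1}[x]gK -{1}[y]gK -gisoM fK.
have gb : bijective g by exists f.
by exists (GIso gM gb).
Qed.

Lemma bf_iso_inj (F : bfunctor R D) G H (f : giso G H) (x y : F G) :
  bf_iso f x = bf_iso f y -> x = y.
Proof.
have [g [fK gK]] := giso_inverse f.
by move=> /(congr1 (bf_iso g)); rewrite !bf_isoM !bf_iso1.
Qed.

Lemma gr_isol G G' H (f : giso G G') (a : A G) (b : A H) :
  gr_mul (bf_iso f a) b = bf_iso (d_prod f (giso_id H)) (gr_mul a b).
Proof. exact: (gm_isol (M := regular A)). Qed.
Lemma gr_isor G H H' (g : giso H H') (a : A G) (b : A H) :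
  gr_mul a (bf_iso g b) = bf_iso (d_prod (giso_id G) g) (gr_mul a b).
Proof. exact: (gm_isor (M := regular A)). Qed.
Lemma gr_assocV G H K (a : A G) (b : A H) (c : A K) :
  gr_mul (gr_mul a b) c = bf_iso (d_assocV G H K) (gr_mul a (gr_mul b c)).
Proof. by rewrite -gr_assoc bf_isoM bf_iso1 // => -[[]]. Qed.
Lemma gm_assocV (M : gmodule A) G H K (a : A G) (b : A H) (m : M K) :
  gm_act (gr_mul a b) m = bf_iso (d_assocV G H K) (gm_act a (gm_act b m)).
Proof. by rewrite -gm_assoc bf_isoM bf_iso1 // => -[[]]. Qed.

Lemma commutantV G (a : A G) H (b : A H) : commutant a ->
  gr_mul b a = bf_iso (d_swap G H) (gr_mul a b).
Proof. by move=> ->; rewrite bf_isoM bf_iso1 // => -[]. Qed.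

Lemma commutant_one : commutant (gr_one A).
Proof.
move=> H b; apply: (@bf_iso_inj _ _ _ (d_unitl H)).
rewrite gr_unitl bf_isoM -[LHS]gr_unitr; apply: bf_iso_ext.
by case.
Qed.

Lemma commutant_sub G (a b : A G) : commutant a -> commutant b -> commutant (a - b).
Proof.
move=> ca cb H c; have -> : a - b = (-1) *: b + a by rewrite scaleN1r addrC.
by rewrite gr_linearl gr_linearr /bf_iso bf_map_linear ca cb.
Qed.

Lemma commutant_mul (a b : A dunit) : commutant a -> commutant b ->
  commutant (edot (M := regular A) a b).
Proof.
move=> ca cb H c; rewrite /edot /= gr_isol gr_isor bf_isoM.
rewrite gr_assocV cb gr_isor -!gr_assoc (ca H c) gr_isol !bf_isoM.
by apply: bf_iso_ext => -[[x []] []].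
Qed.

Definition commutant1_pred : {pred green1 A} :=
  fun a => `[< commutant (a : A dunit) >].

Lemma commutant1_closed : subring_closed commutant1_pred.
Proof.
split=> [|a b /asboolP ca /asboolP cb|a b /asboolP ca /asboolP cb]; apply/asboolP.
- exact: commutant_one.
- exact: commutant_sub.
- exact: commutant_mul.
Qed.
HB.instance Definition _ :=
  GRing.isSubringClosed.Build (green1 A) commutant1_pred commutant1_closed.

Record commutant1 : Type := Commutant1 {
  commutant1_val : green1 A;
  commutant1_valP : commutant1_val \in commutant1_pred
}.
HB.instance Definition _ := [isSub for commutant1_val].
HB.instance Definition _ := [Choice of commutant1 by <:].
HB.instance Definition _ :=
  GRing.SubChoice_isSubPzRing.Build _ _ commutant1 (subringClosedP _).

Definition commutant1_elt (e : commutant1) : A dunit := commutant1_val e.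
Coercion commutant1_elt : commutant1 >-> GRing.Lmodule.sort.

Lemma commutant1P (e : commutant1) : commutant e.
Proof. exact/asboolP/(commutant1_valP e). Qed.
End Commutant.

Section Esub.
Variables (R : comPzRingType) (D : group_class) (A : green R D).
Variables (M : gmodule A).
Implicit Types G H K : dgroup D.

Section Carrier.
Variables (e : A dunit) (H : dgroup D).

Definition esub_pred : {pred M H} := fun x => `[< exists m : M H, x = edot e m >].

Lemma esub_predP x : reflect (exists m : M H, x = edot e m) (x \in esub_pred).
Proof. exact: asboolP. Qed.

Lemma esub_closed : submod_closed esub_pred.
Proof.
split=> [|r a b /esub_predP[m ->] /esub_predP[m' ->]]; apply/esub_predP.
  by exists 0; rewrite (linear_at0 (edot_linearr e)).
by exists (r *: m + m'); rewrite edot_linearr.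
Qed.
HB.instance Definition _ :=
  GRing.isSubmodClosed.Build R (M H) esub_pred esub_closed.

Record esub := Esub { esub_val :> M H; esub_valP : esub_val \in esub_pred }.
HB.instance Definition _ := [isSub for esub_val].
HB.instance Definition _ := [Choice of esub by <:].
HB.instance Definition _ := [SubChoice_isSubLmodule of esub by <:].
End Carrier.

Arguments esub_pred : clear implicits.

Section Functor.
Variable e : A dunit.

Lemma esub_map_proof G H (phi : RB R H G) (x : esub e G) :
  bf_map phi (x : M G) \in esub_pred e H.
Proof.
have /esub_predP[m ->] := esub_valP x.
by apply/esub_predP; exists (bf_map phi m); rewrite edot_nat.
Qed.
Definition esub_map G H (phi : RB R H G) (x : esub e G) : esub e H :=
  Esub (esub_map_proof phi x).

Definition esub_functor : bfunctor R D.
Proof.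
exists (esub e : dgroup D -> lmodType R) esub_map.
- by move=> G H phi r a b; apply: val_inj; apply: bf_map_linear.
- by move=> G H x r phi psi; apply: val_inj; apply: bf_mor_linear.
- by move=> G x; apply: val_inj; apply: bf_id.
- by move=> G H K psi phi x; apply: val_inj; apply: bf_comp.
Defined.
End Functor.

Section Module.
Variable e : commutant1 A.

Lemma gm_edot G H (a : A G) (m : M H) :
  gm_act a (edot e m) = edot e (gm_act a m).
Proof.
rewrite /edot gm_isor -!gm_assoc (commutantV _ (commutant1P e)) gm_isol !bf_isoM.
by apply: bf_iso_ext => -[[[] x] y].
Qed.

Lemma esub_act_proof G H (a : A G) (x : esub e H) :
  gm_act a (x : M H) \in esub_pred e (dgprod G H).
Proof.
have /esub_predP[m ->] := esub_valP x.
by apply/esub_predP; exists (gm_act a m); rewrite gm_edot.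
Qed.

Definition esub_module : gmodule A.
Proof.
exists (esub_functor e) (fun G H a (x : esub e H) => Esub (esub_act_proof a x)).
- by move=> G H x r a b; apply: val_inj; apply: gm_linearl.
- by move=> G H a r x y; apply: val_inj; apply: gm_linearr.
- by move=> G H K a b x; apply: val_inj; apply: gm_assoc.
- by move=> G x; apply: val_inj; apply: gm_unit.
- by move=> G G' H H' phi psi a x; apply: val_inj; apply: gm_nat.
Defined.
End Module.
End Esub.

Section EGreen.
Variables (R : comPzRingType) (D : group_class) (A : green R D).
Variables (e : commutant1 A) (e_idem : e * e = e).
Implicit Types G H K : dgroup D.

Let eA := esub_functor (regular A) e.

Lemma e_edot_e : edot (M := regular A) e (e : A dunit) = e.
Proof. exact: (congr1 (@commutant1_elt R D A) e_idem). Qed.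

Lemma e_edotK G (x : eA G) : edot (M := regular A) e (esub_val x) = esub_val x.
Proof.
have /esub_predP[m ->] := esub_valP x.
by rewrite edot_edot e_edot_e.
Qed.

Definition egreen_mul G H (x : eA G) (y : eA H) : eA (dgprod G H) :=
  Esub (esub_act_proof (esub_val x : A G) y).

Lemma egreen_one_proof : (e : A dunit) \in @esub_pred R D A (regular A) e dunit.
Proof.
apply/esub_predP; exists (gr_one A).
rewrite -[LHS]gr_unitr; apply: bf_iso_ext.
by case=> [[] []].
Qed.
Definition egreen_one : eA dunit := Esub egreen_one_proof.

(* [egreen_mul] is (e x a, e x b) |-> e x (a x b). *)
Lemma egreen_mulE G H (a : A G) (b : A H) :
  gr_mul (edot (M := regular A) e a) (edot (M := regular A) e b) =
  edot (M := regular A) e (gr_mul a b).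
Proof.
have E : gr_mul (edot (M := regular A) e a) (edot (M := regular A) e b) =
         edot (M := regular A) e (gr_mul (edot (M := regular A) e a) b).
  exact: (gm_edot (M := regular A)).
have E' : gr_mul (edot (M := regular A) e a) b = edot (M := regular A) e (gr_mul a b).
  rewrite /edot /= gr_isol -gr_assoc bf_isoM.
  by apply: bf_iso_ext => -[[[] x] y].
by rewrite E E' edot_edot e_edot_e.
Qed.

Definition egreen : green R D.
Proof.
exists eA egreen_mul egreen_one.
- by move=> G H x r a b; apply: val_inj; apply: gr_linearl.
- by move=> G H a r x y; apply: val_inj; apply: gr_linearr.
- by move=> G H K a b x; apply: val_inj; apply: gr_assoc.
- by move=> G x; apply: val_inj; apply: e_edotK.
- move=> G x; apply: val_inj; rewrite /= -[RHS]e_edotK.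
  change (bf_iso (d_unitr G) (gr_mul (esub_val x) e) =
          bf_iso (d_unitl G) (gr_mul e (esub_val x))).
  rewrite (commutantV _ (commutant1P e)) bf_isoM; apply: bf_iso_ext.
  by case.
- by move=> G G' H H' phi psi a x; apply: val_inj; apply: gr_nat.
Defined.
End EGreen.

Section Indecomposable.
Variables (R : comPzRingType) (D : group_class) (A : green R D).

Definition gm_zero (M : gmodule A) : Prop := forall G (m : M G), m = 0.

Section DirectSum.
Variables M N : gmodule A.

Definition dsum_functor : bfunctor R D.
Proof.
exists (fun G => (M G * N G)%type : lmodType R)
       (fun G H phi x => (bf_map phi x.1, bf_map phi x.2)).
- by move=> G H phi r a b; congr pair; apply: bf_map_linear.
- by move=> G H x r phi psi; congr pair; apply: bf_mor_linear.
- by move=> G [x y] /=; rewrite !bf_id.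
- by move=> G H K psi phi x /=; rewrite !bf_comp.
Defined.

Definition dsum : gmodule A.
Proof.
exists dsum_functor (fun G H a x => (gm_act a x.1, gm_act a x.2)).
- by move=> G H x r a b; congr pair; apply: gm_linearl.
- by move=> G H a r x y; congr pair; apply: gm_linearr.
- by move=> G H K a b x; congr pair; apply: gm_assoc.
- by move=> G [x y]; congr pair; apply: gm_unit.
- by move=> G G' H H' phi psi a x; congr pair; apply: gm_nat.
Defined.
End DirectSum.
End Indecomposable.

Section ModuleCategory.
Variables (R : comPzRingType) (D : group_class) (A : green R D).

Definition gmod_id (M : gmodule A) : gmod_hom M M.
Proof. by exists (fun G m => m). Defined.

Definition gmod_comp (M N P : gmodule A) (g : gmod_hom N P) (f : gmod_hom M N) :
  gmod_hom M P.
Proof.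
exists (fun G m => g G (f G m)).
- by move=> G r a b; rewrite !gh_linear.
- by move=> G H phi m; rewrite !gh_nat.
- by move=> G H a m; rewrite !gh_act.
Defined.

Definition gmod_category : category.
Proof.
by exists (gmodule A) (@gmod_hom R D A) gmod_id gmod_comp => *; apply: gmod_hom_ext.
Defined.

Definition indecomposable (M : gmod_category) : Prop :=
  ~ gm_zero M /\
  forall N P : gmod_category, isoc M (dsum N P : gmod_category) -> gm_zero N \/ gm_zero P.
End ModuleCategory.

(* Main.v *)
Require Import Defs.
From HB Require Import structures.
From mathcomp Require Import all_boot all_order all_fingroup all_algebra.
From mathcomp Require Import boolp.
Import GRing.Theory.
Local Open Scope ring_scope.

(* The endomorphisms m |-> e_i m of an A-module M are orthogonal idempotents
   with sum the identity, and they are A-linear because the e_i lie in the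
   commutant; so M is the direct sum of the e_i M, and A acts on e_i M through
   a |-> e_i a.  This gives M |-> (e_i M)_i; a family (N_i)_i of modules over
   the e_i A is sent to the product of the N_i, with a acting on the i-th factor
   as e_i a.  For the second part apply M = e_i M + (1 - e_i) M. *)

Set Implicit Arguments.
Unset Strict Implicit.

(** * Bijections and natural isomorphisms *)

Section Bijective.
Variables (A B : Type) (f : A -> B).

Lemma bijective_surj_inj : injective f -> (forall y, exists x, f x = y) -> bijective f.
Proof.
move=> fI fS; pose g y := sval (cid (fS y)).
have gK y : f (g y) = y by rewrite /g; case: cid.
by exists g => // x; apply: fI; rewrite gK.
Qed.
End Bijective.

(** The inverses, given only object by object, are assembled into one family by the choice operator
    [cid]. *)
Lemma nat_iso_pointwise (C D : category) (F G : functor C D)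
    (a : forall x, Defs.hom (F x) (G x)) :
  (forall x y (f : Defs.hom x y), compc (fmap G f) (a x) = compc (a y) (fmap F f)) ->
  (forall x, exists b, compc b (a x) = idc (F x) /\ compc (a x) b = idc (G x)) ->
  nat_iso F G.
Proof.
move=> aN aI; exists a, (fun x => sval (cid (aI x))); split=> // x.
by case: cid.
Qed.

(** * Products of families of [R]-modules *)

Section DepProd.
Variables (R : pzRingType) (I : Type) (V : I -> lmodType R).

Definition dep_prod : Type := forall i, V i.

Definition dep_prod_add (x y : dep_prod) : dep_prod := fun i => x i + y i.
Definition dep_prod_opp (x : dep_prod) : dep_prod := fun i => - x i.
Definition dep_prod_scale (r : R) (x : dep_prod) : dep_prod := fun i => r *: x i.

Lemma dep_prodP (x y : dep_prod) : (forall i, x i = y i) -> x = y.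
Proof. exact: functional_extensionality_dep. Qed.

HB.instance Definition _ := gen_eqMixin dep_prod.
HB.instance Definition _ := gen_choiceMixin dep_prod.

Let addA : associative dep_prod_add.
Proof. by move=> x y z; apply: dep_prodP => i; apply: addrA. Qed.
Let addC : commutative dep_prod_add.
Proof. by move=> x y; apply: dep_prodP => i; apply: addrC. Qed.
Let add0 : left_id (fun i => 0 : V i) dep_prod_add.
Proof. by move=> x; apply: dep_prodP => i; apply: add0r. Qed.
Let addN : left_inverse (fun i => 0 : V i) dep_prod_opp dep_prod_add.
Proof. by move=> x; apply: dep_prodP => i; apply: addNr. Qed.
HB.instance Definition _ := GRing.isZmodule.Build dep_prod addA addC add0 addN.

Let scaleA r s x : dep_prod_scale r (dep_prod_scale s x) = dep_prod_scale (r * s) x.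
Proof. by apply: dep_prodP => i; apply: scalerA. Qed.
Let scale1 : left_id 1 dep_prod_scale.
Proof. by move=> x; apply: dep_prodP => i; apply: scale1r. Qed.
Let scaleDr : right_distributive dep_prod_scale +%R.
Proof. by move=> r x y; apply: dep_prodP => i; apply: scalerDr. Qed.
Let scaleDl x : {morph dep_prod_scale^~ x : r s / r + s}.
Proof. by move=> r s; apply: dep_prodP => i; apply: scalerDl. Qed.
HB.instance Definition _ :=
  GRing.Zmodule_isLmodule.Build R dep_prod scaleA scale1 scaleDr scaleDl.
End DepProd.

(** * Isomorphisms of modules over a Green functor *)

Section ModuleHom.
Variables (R : comPzRingType) (D : group_class) (A : green R D).
Implicit Types M N : gmod_category A.

(** Each law for the pointwise inverse holds after applying the injective map [f], where it becomes
    the same law for [f]. *)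
Lemma gmod_hom_inverse (M N : gmod_category A) (f : Defs.hom M N) :
  (forall G, bijective (gh_fun f (G := G))) ->
  exists g : Defs.hom N M, compc g f = idc M /\ compc f g = idc N.
Proof.
move=> fb.
have fb' G : exists g : (N : gmodule A) G -> (M : gmodule A) G,
    cancel (gh_fun f (G := G)) g /\ cancel g (gh_fun f (G := G)).
  by have [g] := fb G; exists g.
pose g G := sval (cid (fb' G)).
have gK G : cancel (gh_fun f (G := G)) (g G) by rewrite /g; case: cid => ? [].
have fK G : cancel (g G) (gh_fun f (G := G)) by rewrite /g; case: cid => ? [].
have gl G : linear (g G).
  by move=> r x y; apply: (can_inj (gK G)); rewrite gh_linear !fK.
have gn (G H : dgroup D) (phi : RB R H G) x : g H (bf_map phi x) = bf_map phi (g G x).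
  by apply: (can_inj (gK H)); rewrite gh_nat !fK.
have ga (G H : dgroup D) (a : A G) x : g _ (gm_act a x) = gm_act a (g H x).
  by apply: (can_inj (gK _)); rewrite gh_act !fK.
exists (GModHom gl gn ga).
by split; apply: gmod_hom_ext => G x; [apply: gK|apply: fK].
Qed.

Lemma isoc_bijective M N (f : Defs.hom M N) :
  (forall G, bijective (gh_fun f (G := G))) -> isoc M N.
Proof. by move=> /gmod_hom_inverse[g gK]; exists f, g. Qed.
End ModuleHom.

(** * The action of $A(1)$ on $M(H)$ *)

Section Edot.
Variables (R : comPzRingType) (D : group_class) (A : green R D) (M : gmodule A).
Variable H : dgroup D.
Implicit Types (m : M H) (e f : commutant1 A).

Lemma edotM e f m : edot (e * f : commutant1 A) m = edot e (edot f m).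
Proof. by rewrite edot_edot. Qed.

Lemma edot0l m : edot (0 : A dunit) m = 0.
Proof. exact: linear_at0 (edot_linearl m). Qed.

Lemma edot0r (a : A dunit) : edot a (0 : M H) = 0.
Proof. exact: linear_at0 (edot_linearr _). Qed.

Lemma edotDl (a b : A dunit) m : edot (a + b) m = edot a m + edot b m.
Proof. by rewrite -[a]scale1r edot_linearl !scale1r. Qed.

Lemma edot_suml (I : Type) (r : seq I) (a : I -> A dunit) m :
  edot (\sum_(i <- r) a i) m = \sum_(i <- r) edot (a i) m.
Proof.
elim: r => [|i r IH]; first by rewrite !big_nil edot0l.
by rewrite !big_cons edotDl IH.
Qed.

Lemma edot_sumr (I : Type) (r : seq I) (a : A dunit) (m : I -> M H) :
  edot a (\sum_(i <- r) m i) = \sum_(i <- r) edot a (m i).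
Proof.
elim: r => [|i r IH]; first by rewrite !big_nil edot0r.
by rewrite !big_cons -[X in edot a (X + _)]scale1r edot_linearr scale1r IH.
Qed.

Lemma edot_in e m : edot e m \in esub_pred e (H:=H).
Proof. by apply/esub_predP; exists m. Qed.
End Edot.

(** Associativity alone gives this, so [e] is any element of $A(1)$; moving [e] out of the second
    argument ([gm_edot]) uses the commutant. *)
Lemma gm_edotl (R : comPzRingType) (D : group_class) (A : green R D)
    (M : gmodule A) (e : A dunit) (G H : dgroup D) (a : A G) (m : M H) :
  gm_act (edot (M := regular A) e a) m = edot e (gm_act a m).
Proof.
rewrite /edot /= gm_isol -gm_assoc bf_isoM.
by apply: bf_iso_ext => -[[[] x] y].
Qed.

(** * From $A$-modules to $eA$-modules, and the morphism $A \to eA$ *)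

Section Restriction.
Variables (R : comPzRingType) (D : group_class) (A : green R D).
Variables (e : commutant1 A) (e_idem : e * e = e).

Lemma edotK (M : gmodule A) H (x : esub M e H) : edot e (esub_val x) = esub_val x.
Proof.
have /esub_predP[m ->] := esub_valP x.
by rewrite -edotM e_idem.
Qed.

(** Elements of $eA$ act on $eM$ as the elements of $A$ that they are; the unit of $eA$ is [e],
    which fixes $eM$ by [edotK]. *)
Definition restr_module (M : gmodule A) : gmodule (egreen e_idem).
Proof.
exists (esub_functor M e)
  (fun G H (a : egreen e_idem G) (x : esub M e H) =>
     Esub (esub_act_proof (esub_val a : A G) x)).
- by move=> G H x r a b; apply: val_inj; apply: gm_linearl.
- by move=> G H a r x y; apply: val_inj; apply: gm_linearr.
- by move=> G H K a b x; apply: val_inj; apply: gm_assoc.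
- by move=> G x; apply: val_inj; apply: edotK.
- by move=> G G' H H' phi psi a x; apply: val_inj; apply: gm_nat.
Defined.

Lemma gmod_hom_edot (M N : gmodule A) (f : gmod_hom M N) H (a : A dunit) (m : M H) :
  f H (edot a m) = edot a (f H m).
Proof. by rewrite /edot /bf_iso gh_nat gh_act. Qed.

(** Since $x = ex$ and [f] commutes with [e], $f(x) = e f(x)$. *)
Lemma restr_hom_proof (M N : gmodule A) (f : gmod_hom M N) H (x : esub M e H) :
  f H (esub_val x) \in esub_pred (M := N) e (H:=H).
Proof. by rewrite -edotK gmod_hom_edot edot_in. Qed.

Definition restr_hom (M N : gmodule A) (f : gmod_hom M N) :
  gmod_hom (restr_module M) (restr_module N).
Proof.
exists (fun H (x : esub M e H) => Esub (restr_hom_proof f x)).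
- by move=> G r a b; apply: val_inj; apply: gh_linear.
- by move=> G H phi m; apply: val_inj; apply: gh_nat.
- by move=> G H a m; apply: val_inj; apply: gh_act.
Defined.

(** The next four lemmas show that this is a morphism of Green functors, along which $eA$-modules
    pull back to $A$-modules. *)
Definition to_egreen G (a : A G) : egreen e_idem G := Esub (edot_in (M := regular A) e a).

Lemma to_egreen_one : to_egreen (gr_one A) = gr_one (egreen e_idem).
Proof.
apply: val_inj => /=; rewrite /edot -[RHS]gr_unitr; apply: bf_iso_ext.
by case=> [[] []].
Qed.

Lemma to_egreenM G H (a : A G) (b : A H) :
  to_egreen (gr_mul a b) = gr_mul (to_egreen a) (to_egreen b).
Proof. by apply: val_inj; rewrite /= egreen_mulE. Qed.

Lemma to_egreen_map (G H : dgroup D) (phi : RB R H G) (a : A G) :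
  to_egreen (bf_map phi a) = bf_map phi (to_egreen a).
Proof. by apply: val_inj; apply/esym/(edot_nat (M := regular A)). Qed.

Lemma to_egreen_linear G : linear (@to_egreen G).
Proof. by move=> r a b; apply: val_inj; apply: edot_linearr. Qed.
End Restriction.

(** * The equivalence with the product category *)

Section Decomposition.
Variables (R : comPzRingType) (D : group_class) (A : green R D).
Variables (n : nat) (e : 'I_n -> commutant1 A).
Hypothesis e_idem : forall i : 'I_n, e i * e i = e i.
Hypothesis e_orth : forall i j : 'I_n, i != j -> e i * e j = 0.
Hypothesis e_sum : \sum_(i < n) (e i : A dunit) = gr_one A.

Let C := gmod_category A.
Let E := product_category (fun i => gmod_category (egreen (e_idem i))).

Lemma edot_orth (M : gmodule A) H (m : M H) i j :
  i != j -> edot (e i) (edot (e j) m) = 0.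
Proof. by move=> ij; rewrite -edotM e_orth // edot0l. Qed.

Lemma edot_sum1 (M : gmodule A) H (m : M H) : \sum_(i < n) edot (e i) m = m.
Proof. by rewrite -edot_suml e_sum; apply: gm_unit. Qed.

Definition restr_functor : functor C E.
Proof.
exists (fun (M : C) i => restr_module (e_idem i) M)
       (fun (M N : C) f i => restr_hom (e_idem i) f).
- by move=> M; apply: functional_extensionality_dep => i;
    apply: gmod_hom_ext => G x; apply: val_inj.
- by move=> M N P g f; apply: functional_extensionality_dep => i;
    apply: gmod_hom_ext => G x; apply: val_inj.
Defined.

Definition prod_functor (N : E) : bfunctor R D.
Proof.
exists (fun G => dep_prod (fun i => (N i : gmodule _) G) : lmodType R)
       (fun G H phi x i => bf_map phi (x i)).
- by move=> G H phi r a b; apply: dep_prodP => i; apply: bf_map_linear.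
- by move=> G H x r a b; apply: dep_prodP => i; apply: bf_mor_linear.
- by move=> G x; apply: dep_prodP => i; apply: bf_id.
- by move=> G H K psi phi x; apply: dep_prodP => i; apply: bf_comp.
Defined.

Definition prod_module (N : E) : gmodule A.
Proof.
exists (prod_functor N)
       (fun G H a (x : prod_functor N H) i => gm_act (to_egreen (e_idem i) a) (x i)).
- by move=> G H x r a b; apply: dep_prodP => i; rewrite to_egreen_linear gm_linearl.
- by move=> G H a r x y; apply: dep_prodP => i; apply: gm_linearr.
- by move=> G H K a b x; apply: dep_prodP => i; rewrite /= -gm_assoc -to_egreenM.
- by move=> G x; apply: dep_prodP => i; rewrite -[RHS]gm_unit -to_egreen_one.
- move=> G G' H H' phi psi a x; apply: dep_prodP => i.
  by rewrite /= to_egreen_map -gm_nat.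
Defined.

Definition prod_hom (M N : E) (f : Defs.hom M N) : gmod_hom (prod_module M) (prod_module N).
Proof.
exists (fun H (x : prod_functor M H) i => gh_fun (f i) (x i)).
- by move=> G r a b; apply: dep_prodP => i; apply: gh_linear.
- by move=> G H phi m; apply: dep_prodP => i; apply: gh_nat.
- by move=> G H a m; apply: dep_prodP => i; apply: gh_act.
Defined.

Definition glue_functor : functor E C.
Proof.
exists (prod_module : E -> C) prod_hom.
- by move=> M; apply: gmod_hom_ext.
- by move=> M N P g f; apply: gmod_hom_ext.
Defined.

Lemma prod_edot (N : E) H (x : prod_module N H) (a : A dunit) i :
  edot a x i = edot (A := egreen (e_idem i)) (to_egreen (e_idem i) a) (x i).
Proof. by []. Qed.

(** The image of $e_i$ in $e_iA$ is $e_i e_i = e_i$, the identity element there. *)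
Lemma prod_edot_same (N : E) H (x : prod_module N H) i : edot (e i) x i = x i.
Proof.
rewrite prod_edot -[RHS]gm_unit /edot; congr (bf_iso _ (gm_act _ _)).
by apply: val_inj; rewrite /= e_edot_e.
Qed.

(** The image of $e_i$ in $e_jA$ is $e_j e_i = 0$. *)
Lemma prod_edot_diff (N : E) H (x : prod_module N H) i j :
  i != j -> edot (e i) x j = 0.
Proof.
move=> ij; rewrite prod_edot (_ : to_egreen _ _ = 0) ?edot0l //.
apply: val_inj; rewrite /=.
by rewrite -[LHS]/(commutant1_elt (e j * e i)) e_orth // eq_sym.
Qed.

Definition split_hom (M : gmodule A) : gmod_hom M (prod_module (restr_functor M)).
Proof.
exists (fun H (m : M H) i => Esub (edot_in (e i) m) : esub M (e i) H).
- by move=> G r a b; apply: dep_prodP => i; apply: val_inj; apply: edot_linearr.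
- move=> G H phi m; apply: dep_prodP => i; apply: val_inj => /=.
  by rewrite edot_nat.
- move=> G H a m; apply: dep_prodP => i; apply: val_inj => /=.
  (* Here $(e_i a) \times (e_i m) = e_i e_i (a \times m) = e_i (a \times m)$. *)
  by rewrite gm_edotl gm_edot -edotM e_idem.
Defined.

Lemma split_hom_bijective (M : gmodule A) H : bijective (split_hom M H).
Proof.
(* The inverse adds the components: $\sum_i e_i m = m$, and conversely $e_i$ kills every component
   $x_j = e_j x_j$ with $j \neq i$. *)
exists (fun x => \sum_(i < n) esub_val (x i)) => [m|x] /=.
  exact: edot_sum1.
apply: dep_prodP => i; apply: val_inj => /=.
rewrite edot_sumr (bigD1 i) //= edotK // big1 ?addr0 // => j ji.
by rewrite -(edotK (e_idem j)) edot_orth // eq_sym.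
Qed.

Lemma restr_glue_iso : nat_iso (functor_id C) (functor_comp glue_functor restr_functor).
Proof.
apply: (@nat_iso_pointwise _ _ (functor_id C) (functor_comp glue_functor restr_functor)
  split_hom).
- move=> M N f; apply: gmod_hom_ext => H m; apply: dep_prodP => i; apply: val_inj => /=.
  by rewrite gmod_hom_edot.
- move=> M; apply: gmod_hom_inverse; exact: split_hom_bijective.
Qed.

(** This is $e_iA$-linear because an element $a$ of $e_iA$ satisfies $e_i a = a$, so [to_egreen]
    sends it back to itself. *)
Definition proj_hom (N : E) i : gmod_hom (restr_module (e_idem i) (prod_module N)) (N i).
Proof.
exists (fun H (x : esub (prod_module N) (e i) H) => (esub_val x : prod_module N H) i).
- by [].
- by [].
- move=> G H a x /=; congr (gm_act _ _); apply: val_inj => /=.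
  exact: e_edotK.
Defined.

Lemma proj_hom_bijective (N : E) i H : bijective (proj_hom N i H).
Proof.
apply: bijective_surj_inj => [x y /= xy|y].
  (* Injectivity: an element of $e_i \prod_j N_j$ has zero coordinates away from [i]. *)
  apply/val_inj/dep_prodP => j /=; have [<- //|ij] := eqVneq i j.
  by rewrite -(edotK (e_idem i) x) -(edotK (e_idem i) y) !prod_edot_diff.
(* Surjectivity: [z] is [y] in coordinate [i] and zero elsewhere. *)
pose z : prod_module N H := dfwith (fun j => 0 : (N j : gmodule _) H) y.
exists (Esub (edot_in (e i) z)).
by rewrite [LHS]prod_edot_same /z dfwith_in.
Qed.

Lemma glue_restr_iso : nat_iso (functor_comp restr_functor glue_functor) (functor_id E).
Proof.
apply: (@nat_iso_pointwise _ _ (functor_comp restr_functor glue_functor) (functor_id E)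
  proj_hom).
- move=> M N f; apply: functional_extensionality_dep => i; exact: gmod_hom_ext.
- move=> N.
  have inv i := gmod_hom_inverse (proj_hom_bijective N i).
  exists (fun i => sval (cid (inv i))).
  by split; apply: functional_extensionality_dep => i /=; case: cid => ? [].
Qed.
End Decomposition.

(** Naturality of [b] follows from $F(f) b_x = b_y a_y F(f) b_x = b_y G(f) a_x b_x = b_y G(f)$. *)
Lemma nat_iso_sym (C D : category) (F G : functor C D) : nat_iso F G -> nat_iso G F.
Proof.
case=> a [b [aN ab]]; exists b, a; split=> [x y f|x]; last by have [] := ab x.
rewrite -[LHS]compc1l -(proj1 (ab y)) -compcA [compc (a y) _]compcA -aN.
by rewrite -compcA (proj2 (ab x)) compc1r.
Qed.

(** * The Peirce decomposition $M = eM \oplus (1-e)M$ and indecomposable modules *)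

Section Indecomposable.
Variables (R : comPzRingType) (D : group_class) (A : green R D).
Variables (e : commutant1 A) (e_idem : e * e = e).
Variable M : gmodule A.

Lemma edot_compl H (m : M H) : edot (1 - e : commutant1 A) m = m - edot e m.
Proof.
apply/eqP; rewrite eq_sym subr_eq -edotDl.
rewrite (_ : _ + _ = gr_one A); first by rewrite [edot _ _]gm_unit.
exact: (congr1 (@commutant1_elt R D A) (subrK e 1)).
Qed.

Definition peirce_hom :
  gmod_hom M (dsum (esub_module M e) (esub_module M (1 - e))).
Proof.
exists (fun H (m : M H) => (Esub (edot_in e m), Esub (edot_in (1 - e) m))).
- by move=> G r a b; congr pair; apply: val_inj; apply: edot_linearr.
- by move=> G H phi m; congr pair; apply: val_inj; rewrite /= edot_nat.
- by move=> G H a m; congr pair; apply: val_inj; apply/esym/gm_edot.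
Defined.

Lemma peirce_hom_bijective H : bijective (peirce_hom H).
Proof.
have f_idem : (1 - e) * (1 - e) = 1 - e.
  by rewrite mulrBl mul1r mulrBr mulr1 e_idem subrr subr0.
exists (fun x => esub_val x.1 + esub_val x.2) => [m|[x y]] /=.
  by rewrite edot_compl addrC subrK.
(* The idempotent $1-e$ fixes $y \in (1-e)M$, so $y - ey = y$. *)
have ey : edot e (esub_val y) = 0.
  have := edotK f_idem y; rewrite edot_compl => /eqP.
  by rewrite -subr_eq0 addrAC subrr add0r oppr_eq0 => /eqP.
have exy : edot e (esub_val x + esub_val y) = esub_val x.
  by rewrite -[X in edot e (X + _)]scale1r edot_linearr scale1r ey addr0 edotK.
by congr pair; apply: val_inj; rewrite /= ?edot_compl exy // addrAC subrr add0r.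
Qed.

Definition esub_incl : gmod_hom (esub_module M e) M.
Proof. by exists (fun H (x : esub M e H) => esub_val x). Defined.

(** If $(1-e)M = 0$ then $m = em$ for every $m$, so the inclusion of $eM$ is onto. *)
Lemma esub_incl_bijective :
  gm_zero (esub_module M (1 - e)) -> forall H, bijective (esub_incl H).
Proof.
move=> M0 H; apply: bijective_surj_inj => [x y /val_inj //|m].
exists (Esub (edot_in e m)) => /=.
have /(congr1 val)/= := M0 H (Esub (edot_in (1 - e) m)).
by rewrite edot_compl => /subr0_eq.
Qed.

Lemma esub_zeroP : gm_zero (esub_module M e) <-> forall H (m : M H), edot e m = 0.
Proof.
split=> [M0 H m|M0 H x]; first by have /(congr1 val) := M0 H (Esub (edot_in e m)).
by apply: val_inj; rewrite /= -(edotK e_idem) M0.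
Qed.

Lemma indecomposable_edot : indecomposable (M : gmod_category A) ->
  ~ gm_zero (esub_module M e) -> gm_zero (esub_module M (1 - e)).
Proof.
move=> [_ Mi] Me; have [] // := Mi (esub_module M e) (esub_module M (1 - e)).
exact: isoc_bijective peirce_hom_bijective.
Qed.
End Indecomposable.

Unset Implicit Arguments.

Theorem theorem45 (R : comPzRingType) (D : group_class) (A : green R D)
    (n : nat) (e : 'I_n -> commutant1 A)
    (e_idem : forall i : 'I_n, e i * e i = e i)
    (e_orth : forall i j : 'I_n, i != j -> e i * e j = 0)
    (e_sum : \sum_(i < n) (e i : A dunit) = gr_one A) :
  equivalent_categories (gmod_category A)
    (product_category (fun i : 'I_n => gmod_category (egreen (e_idem i)))) /\
  forall M : gmod_category A, indecomposable M ->
    exists i : 'I_n,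
      [/\ ~ gm_zero (esub_module M (e i)),
          forall j : 'I_n, ~ gm_zero (esub_module M (e j)) -> j = i
        & isoc (esub_module M (e i) : gmod_category A) M].
Proof.
split.
  exists (restr_functor e_idem), (glue_functor e_idem); split.
    (* [split_hom] goes from the identity to the composite, hence the reversal. *)
    exact/nat_iso_sym/(restr_glue_iso e_idem e_orth e_sum).
  exact: glue_restr_iso.
move=> M Mi; have [M0 _] := Mi.
have [i Mei] : exists i, ~ gm_zero (esub_module M (e i)).
  apply: contrapT => /forallNP Me; apply: M0 => H m.
  (* If all $e_iM$ vanished, every $m = \sum_i e_i m$ would be zero. *)
  rewrite -(edot_sum1 e_sum m) big1 // => i _.
  by apply: (esub_zeroP (e_idem i) M).1; apply: contrapT (Me i).
have Mi0 := indecomposable_edot (e_idem i) Mi Mei.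
exists i; split=> //; last exact/isoc_bijective/esub_incl_bijective.
move=> j Mej; apply/eqP/negP => ji; apply: Mej.
apply: (esub_zeroP (e_idem j) M).2 => H m.
(* Since $(1-e_i)M = 0$, every $m$ lies in $e_iM$, whence $e_j m = e_j e_i m = 0$. *)
have [x <-] : exists x, esub_incl (e i) M H x = m.
  by have [g _ gK] := esub_incl_bijective Mi0 H; exists (g m).
by rewrite /= -(edotK (e_idem i)) -edotM e_orth ?edot0l //; apply/negP.
Qed.
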